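(* Let $L^{(1)},L^{(2)}$ be prepared Laurent polynomials (with the same $n=m\geq 1$), let $\check u^{(1)},\check u^{(2)}$ be the Geronimus transformations of $u$ described in the context, with all Gram matrices involved quasidefinite, and let $l\ge 2n$. Set, for $k\ge 0$, the row vectors in $\mathbb C^{2n}$ $$A_k:=\mathcal J^{\overline{L^{(2)}}}_{C_{1,k}}-\langle\xi^{(2)},\phi_{1,k}\rangle\mathcal L^{(2)},\qquad B_k:=\mathcal J^{\overline{L^{(1)}}}_{C_{2,k}}-\langle\xi^{(1)},\phi_{2,k}\rangle\mathcal L^{(1)},$$ $$R^{(2)}_l(z):=\overline{L^{(2)}(z)}\Big(\mathcal J^{\overline{L^{(2)}}}_{K^{[l]}_{\phi,C}}(\bar z)-\langle(\xi^{(2)})_x,K^{[l]}(\bar z,x)\rangle\mathcal L^{(2)}\Big)+\overline{\mathcal J^{L^{(2)}}_{\delta L^{(2)}}(z)},$$ $$R^{(1)}_l(z):=\overline{L^{(1)}(z)}\Big(\mathcal J^{\overline{L^{(1)}}}_{\overline{K^{[l]}_{C,\phi}}}(z)-\langle(\xi^{(1)})_x,\overline{K^{[l]}(\bar x,z)}\rangle\mathcal L^{(1)}\Big)+\overline{\mathcal J^{L^{(1)}}_{\delta L^{(1)}}(z)},$$ and $$\check\tau^{(2)}_l:=\begin{vmatrix}A_{l-2n}\\ \vdots\\ A_{l-1}\end{vmatrix},\qquad \check\tau^{(1)}_l:=\begin{vmatrix}B_{l-2n}\\ \vdots\\ B_{l-1}\end{vmatrix}.$$ (i) If $\check\tau^{(2)}_l\neq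 0$, then $$\check\phi^{(2)}_{1,l}(z)=\Theta_*\begin{bmatrix}A_{l-2n}&\phi_{1,l-2n}(z)\\ \vdots&\vdots\\ A_l&\phi_{1,l}(z)\end{bmatrix}=\frac1{\check\tau^{(2)}_l}\begin{vmatrix}A_{l-2n}&\phi_{1,l-2n}(z)\\ \vdots&\vdots\\ A_l&\phi_{1,l}(z)\end{vmatrix},$$ $$\check H^{(2)}_l=\frac{H_{l-2n}}{\overline{L^{(2)}_{(-1)^ln}}}\,\Theta_*\begin{bmatrix}A_{l-2n}&1\\ A_{l-2n+1}&0\\ \vdots&\vdots\\ A_l&0\end{bmatrix}=\frac{H_{l-2n}}{\overline{L^{(2)}_{(-1)^ln}}}\,\frac{\check\tau^{(2)}_{l+1}}{\check\tau^{(2)}_l},$$ $$\overline{\check\phi^{(2)}_{2,l}(z)}=-\frac{H_{l-2n}}{\overline{L^{(2)}_{(-1)^ln}}}\,\Theta_*\begin{bmatrix}A_{l-2n}&1\\ A_{l-2n+1}&0\\ \vdots&\vdots\\ A_{l-1}&0\\ R^{(2)}_l(z)&0\end{bmatrix}=-\frac{H_{l-2n}}{\overline{L^{(2)}_{(-1)^ln}}}\,\frac1{\check\tau^{(2)}_l}\begin{vmatrix}A_{l-2n+1}\\ \vdots\\ A_{l-1}\\ R^{(2)}_l(z)\end{vmatrix}.$$ (ii) If $\check\tau^{(1)}_l\neq 0$, then $$\check\phi^{(1)}_{2,l}(z)=\Theta_*\begin{bmatrix}B_{l-2n}&\phi_{2,l-2n}(z)\\ \vdots&\vdots\\ B_l&\phi_{2,l}(z)\end{bmatrix}=\frac1{\check\tau^{(1)}_l}\begin{vmatrix}B_{l-2n}&\phi_{2,l-2n}(z)\\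 \vdots&\vdots\\ B_l&\phi_{2,l}(z)\end{vmatrix},$$ $$\overline{\check H^{(1)}_l}=\frac{\overline{H_{l-2n}}}{\overline{L^{(1)}_{(-1)^ln}}}\,\Theta_*\begin{bmatrix}B_{l-2n}&1\\ B_{l-2n+1}&0\\ \vdots&\vdots\\ B_l&0\end{bmatrix}=\frac{\overline{H_{l-2n}}}{\overline{L^{(1)}_{(-1)^ln}}}\,\frac{\check\tau^{(1)}_{l+1}}{\check\tau^{(1)}_l},$$ $$\overline{\check\phi^{(1)}_{1,l}(z)}=-\frac{\overline{H_{l-2n}}}{\overline{L^{(1)}_{(-1)^ln}}}\,\Theta_*\begin{bmatrix}B_{l-2n}&1\\ B_{l-2n+1}&0\\ \vdots&\vdots\\ B_{l-1}&0\\ R^{(1)}_l(z)&0\end{bmatrix}=-\frac{\overline{H_{l-2n}}}{\overline{L^{(1)}_{(-1)^ln}}}\,\frac1{\check\tau^{(1)}_l}\begin{vmatrix}B_{l-2n+1}\\ \vdots\\ B_{l-1}\\ R^{(1)}_l(z)\end{vmatrix}.$$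
   Context: Indices start at $0$; $\mathbb C^*=\mathbb C\setminus\{0\}$; $\sigma(L)$ is the zero set of $L$ in $\mathbb C^*$; a bar over a set is the set of complex conjugates; for a function $F$, $\overline F(z):=\overline{F(\bar z)}$ (so $\overline L$ is the Laurent polynomial with conjugated coefficients). CMV sequence: $\chi(z)=[1,z^{-1},z,z^{-2},z^2,\dots]^\top$. Functionals. A bivariate linear functional $v=v_{z_1,\bar z_2}$ is a continuous linear functional with a well-defined closed support $\operatorname{supp}(v)\subset\mathbb C^*\times\mathbb C^*$ on a space of test functions (for example a compactly supported distribution) containing all $f(z_1)\otimes\overline{g(z_2)}:=f(z_1)\overline{g(z_2)}$ with $f,g$ Laurent polynomials or, more generally, rational functions whose nonzero poles lie outside $\operatorname{supp}_1(v)$, resp. $\operatorname{supp}_2(v)$ (the closed projections of the support onto the $z_1$-, resp. $z_2$-coordinate); by continuity one can differentiate under the pairing with respect to the position of the pole of Cauchy kernels. Put $\langle f(z_1),g(z_2)\rangle_v=\langle v,f(z_1)\otimes\overline{g(z_2)}\rangle$. The Gram matrix of $v$ has entries $\langle\chi^{(k)},\chi^{(l)}\rangle_v$. It is quasidefinite if all leading principal minors are nonzero. Let $u$ be a bivariate functional with quasidefinite Gram matrix $G=S_1^{-1}H(S_2^{-1})^\dagger$ ($S_a$ lower unitriangular, $H=\operatorname{diag}(H_0,H_1,\dots)$). Put $\phi_a=S_a\chi=[\phi_{a,0},\phi_{a,1},\dots]^\top$, $K^{[l]}(\bar z_1,z_2)=\sum_{k=0}^{l-1}\overline{\phi_{2,k}(z_1)}H_k^{-1}\phi_{1,k}(z_2)$.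 Cauchy second kind functions: $C_{1,k}(z)=\langle\phi_{1,k}(z_1),\frac1{\bar z-z_2}\rangle_u$ for $z\notin\overline{\operatorname{supp}_2(u)}$, and $\overline{C_{2,k}(z)}=\langle\frac1{\bar z-z_1},\phi_{2,k}(z_2)\rangle_u$ for $z\notin\overline{\operatorname{supp}_1(u)}$. Mixed kernels: $K^{[l]}_{C,\phi}(\bar z_1,z_2)=\sum_{k=0}^{l-1}\overline{C_{2,k}(z_1)}H_k^{-1}\phi_{1,k}(z_2)$, $K^{[l]}_{\phi,C}(\bar z_1,z_2)=\sum_{k=0}^{l-1}\overline{\phi_{2,k}(z_1)}H_k^{-1}C_{1,k}(z_2)$. Prepared Laurent polynomials: $L^{(a)}(z)=L^{(a)}_nz^n+\dots+L^{(a)}_{-n}z^{-n}$, $L^{(a)}_nL^{(a)}_{-n}\neq0$, with zeros $\zeta^{(a)}_i\in\mathbb C^*$ of multiplicity $m^{(a)}_i$, $i=1,\dots,d^{(a)}$; $L_{(-1)^ln}$ is $L_n$ for $l$ even, $L_{-n}$ for $l$ odd. Assume $\sigma(L^{(1)})\cap\operatorname{supp}_1(u)=\varnothing$ and $\sigma(L^{(2)})\cap\operatorname{supp}_2(u)=\varnothing$. Geronimus transformations. For given univariate linear functionals $\xi^{(a)}_{i,r}$ ($1\le i\le d^{(a)}$, $0\le r\le m^{(a)}_i-1$), $$\langle f,g\rangle_{\check u^{(1)}}=\Big\langle u,\tfrac{f(z_1)}{L^{(1)}(z_1)}\otimes\overline{g(z_2)}\Big\rangle+\sum_{i,r}\tfrac1{r!}f^{(r)}(\zeta^{(1)}_i)\overline{\langle\xi^{(1)}_{i,r},g\rangle},$$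 $$\langle f,g\rangle_{\check u^{(2)}}=\Big\langle u,f(z_1)\otimes\overline{\tfrac{g(z_2)}{L^{(2)}(z_2)}}\Big\rangle+\sum_{i,r}\tfrac1{r!}\langle\xi^{(2)}_{i,r},f\rangle\overline{g^{(r)}(\zeta^{(2)}_i)},$$ so that $L^{(1)}(z_1)\check u^{(1)}=u$ and $\check u^{(2)}\overline{L^{(2)}(z_2)}=u$. The Gram matrices of $\check u^{(1)}$ and $\check u^{(2)}$ are assumed quasidefinite; quantities $\check H^{(a)}_k,\check\phi^{(a)}_{1,k},\check\phi^{(a)}_{2,k}$ are the corresponding objects for $\check u^{(a)}$. Jets. If $L$ has zeros $\zeta_1,\dots,\zeta_d$ with multiplicities $m_1,\dots,m_d$, then $\mathcal J^L_f=[f(\zeta_1),f'(\zeta_1),\dots,\frac{f^{(m_1-1)}(\zeta_1)}{(m_1-1)!},\dots,f(\zeta_d),\dots,\frac{f^{(m_d-1)}(\zeta_d)}{(m_d-1)!}]$. $\overline{L}$ has zeros $\bar\zeta_i$ (same order, same multiplicities). $\mathcal J^{\overline{L^{(2)}}}_{K_{\phi,C}^{[l]}}(\bar z)$ is the jet of $x\mapsto K^{[l]}_{\phi,C}(\bar z,x)$; $\mathcal J^{\overline{L^{(1)}}}_{\overline{K^{[l]}_{C,\phi}}}(z)$ is the jet of $x\mapsto\overline{K^{[l]}_{C,\phi}(\bar x,z)}$; $\mathcal J^{L}_{\delta L}(z)$ is the jet of $x\mapsto\delta L(x,z)=\delta L(z,x)$, with $\delta L(x,y)=\frac{L(x)-L(y)}{x-y}$.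 $\langle\xi^{(a)},f\rangle$ is the row vector $[\langle\xi^{(a)}_{1,0},f\rangle,\dots,\langle\xi^{(a)}_{1,m^{(a)}_1-1},f\rangle,\dots,\langle\xi^{(a)}_{d^{(a)},0},f\rangle,\dots,\langle\xi^{(a)}_{d^{(a)},m^{(a)}_{d^{(a)}}-1},f\rangle]$; in $\langle(\xi^{(a)})_x,F(x)\rangle$ it acts on the variable $x$. Matrices $\mathcal L^{(a)}=\operatorname{diag}(\mathcal L^{(a)}_{[1]},\dots,\mathcal L^{(a)}_{[d^{(a)}]})$: with $L^{(a)}_{[j]}(z)=L^{(a)}_nz^{-n}\prod_{i\ne j}(z-\zeta^{(a)}_i)^{m^{(a)}_i}$ and $\ell^{(a)}_{[j],k}=\frac1{k!}\frac{d^k\overline{L^{(a)}_{[j]}}(z)}{dz^k}\big|_{z=\overline{\zeta^{(a)}_j}}$, the block $\mathcal L^{(a)}_{[j]}$ is the $m^{(a)}_j\times m^{(a)}_j$ matrix whose $(p,q)$ entry ($0\le p,q\le m^{(a)}_j-1$) is $\ell^{(a)}_{[j],\,p+q-m^{(a)}_j+1}$ if $p+q\ge m^{(a)}_j-1$ and $0$ otherwise. Quasideterminant: $\Theta_*\begin{bmatrix}A&B\\C&D\end{bmatrix}=D-CA^{-1}B=\begin{vmatrix}A&B\\C&D\end{vmatrix}/|A|$ ($A$ square invertible, $B$ column, $C$ row, $D$ scalar). *)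

(* Defs.v *)
From HB Require Import structures.
From mathcomp Require Import all_boot all_order all_algebra.
From mathcomp Require Import complex.
From mathcomp Require Import all_classical all_reals all_analysis.

Set Implicit Arguments.
Unset Strict Implicit.
Unset Printing Implicit Defensive.

Import Order.TTheory GRing.Theory Num.Theory.
Import numFieldNormedType.Exports.

Local Open Scope classical_set_scope.
Local Open Scope ring_scope.

Definition Cplx (R : realType) : numClosedFieldType := R[i].

(* Functions on the punctured plane are functions C -> C whose value at 0 is
   irrelevant. *)
Definition Cstar (C : numClosedFieldType) : set C := [set z | z != 0].

Definition Cstar2 (C : numClosedFieldType) : set (C * C) :=
  [set x | x.1 != 0 /\ x.2 != 0].

Arguments Cstar : clear implicits.
Arguments Cstar2 : clear implicits.

Definition laurent (C : numClosedFieldType) (f : C -> C) : Prop :=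
  exists (p : {poly C}) (N : nat), forall z, z != 0 -> f z = p.[z] / z ^+ N.

(* Rational functions all of whose nonzero poles lie outside S; the value at a
   pole is irrelevant. *)
Definition rational_off (C : numClosedFieldType) (S : set C) (f : C -> C) : Prop :=
  exists p q : {poly C},
    [/\ q != 0,
        forall z, z != 0 -> S z -> q.[z] != 0 &
        forall z, z != 0 -> q.[z] != 0 -> f z = p.[z] / q.[z]].

Definition tensor (C : numClosedFieldType) (f g : C -> C) (x : C * C) : C :=
  f x.1 * (g x.2)^*.

(* A topological vector space of test functions.  Elements are evaluated on
   C^* x C^*; several elements may have the same values near a given set. *)
Record test_space (C : numClosedFieldType) := TestSpace {
  test_sort :> topologicalLmodType C;
  ev : test_sort -> C * C -> C;
  ev_linear : forall x, scalar (ev^~ x)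
}.

(* F coincides with h on a neighbourhood of S. *)
Definition represents (C : numClosedFieldType) (E : test_space C)
    (S : set (C * C)) (F : E) (h : C * C -> C) : Prop :=
  forall x, S x -> \forall y \near x, ev F y = h y.

Definition carries (C : numClosedFieldType) (E : test_space C) (v : E -> C)
    (S : set (C * C)) : Prop :=
  forall F : E, represents S F (fun=> 0) -> v F = 0.

Definition closed_in_Cstar2 (C : numClosedFieldType) (S : set (C * C)) : Prop :=
  S `<=` Cstar2 C /\ closure S `&` Cstar2 C `<=` S.

(* The support is the least relatively closed set that carries v. *)
Definition is_support (C : numClosedFieldType) (E : test_space C) (v : E -> C)
    (S : set (C * C)) : Prop :=
  [/\ closed_in_Cstar2 S, carries v S &
      forall T, closed_in_Cstar2 T -> carries v T -> S `<=` T].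

Definition proj1 (C : numClosedFieldType) (S : set (C * C)) : set C :=
  closure (fst @` S) `&` Cstar C.

Definition proj2 (C : numClosedFieldType) (S : set (C * C)) : set C :=
  closure (snd @` S) `&` Cstar C.

(* The last two fields say that the test space contains the Cauchy kernels and
   their powers as families that are differentiable, in the topology of the
   test space, with respect to the position of the pole; since the functional is
   continuous, one can then differentiate under the pairing.  In the second
   variable the tensor is antilinear, whence the pole at w^* . *)
Record bivariate (C : numClosedFieldType) := Bivariate {
  test : test_space C;
  pairing : test -> C;
  supp : set (C * C);
  pairing_linear : scalar pairing;
  pairing_continuous : continuous pairing;
  supp_support : is_support pairing supp;
  test_tensor : forall f g,
    rational_off (proj1 supp) f -> rational_off (proj2 supp) g ->
    exists F : test, represents supp F (tensor f g);
  test_cauchy1 : forall (k : nat) (g : C -> C) (p : C),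
    rational_off (proj2 supp) g -> p != 0 -> ~ proj1 supp p ->
    exists (kappa : C -> test) (D : test),
      [/\ \forall w \near p,
            represents supp (kappa w) (tensor (fun z => (w - z) ^- k) g),
          represents supp D (tensor (fun z => - k%:R * (p - z) ^- k.+1) g) &
          h^-1 *: (kappa (h + p) - kappa p) @[h --> 0^'] --> D];
  test_cauchy2 : forall (k : nat) (f : C -> C) (p : C),
    rational_off (proj1 supp) f -> p != 0 -> ~ proj2 supp p^* ->
    exists (kappa : C -> test) (D : test),
      [/\ \forall w \near p,
            represents supp (kappa w) (tensor f (fun z => (w^* - z) ^- k)),
          represents supp D (tensor f (fun z => - k%:R * (p^* - z) ^- k.+1)) &
          h^-1 *: (kappa (h + p) - kappa p) @[h --> 0^'] --> D]
}.

Definition supp1 (C : numClosedFieldType) (v : bivariate C) : set C := proj1 (supp v).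

Definition supp2 (C : numClosedFieldType) (v : bivariate C) : set C := proj2 (supp v).

(* <f, g>_v; independent of the test function chosen, see pairE. *)
Definition pair (C : numClosedFieldType) (v : bivariate C) (f g : C -> C) : C :=
  pairing (xget 0 [set F : test v | represents (supp v) F (tensor f g)]).

Lemma pairE (C : numClosedFieldType) (v : bivariate C) (f g : C -> C) (F : test v) :
  represents (supp v) F (tensor f g) -> pair v f g = pairing F.
Proof.
move=> FP; rewrite /pair.
set G := xget _ _.
have GP : represents (supp v) G (tensor f g).
  apply: (@xgetPex _ 0 [set F' : test v | represents (supp v) F' (tensor f g)]).
  by exists F.
have [_ carry _] := supp_support v.
have evB x : ev (-1 *: F + G) x = - ev F x + ev G x.
  by have := ev_linear x (-1) F G; rewrite mulN1r.
have : pairing (-1 *: F + G) = 0.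
  apply: carry => x Sx.
  have nF := FP x Sx; have nG := GP x Sx.
  near=> y; rewrite evB.
  have -> : ev F y = tensor f g y by near: y.
  have -> : ev G y = tensor f g y by near: y.
  by rewrite addNr.
by rewrite (@pairing_linear _ v (-1) F G) mulN1r addrC => /subr0_eq.
Unshelve. all: by end_near. Qed.

(* A univariate linear functional, on the space of Laurent polynomials. *)
Record univariate (C : numClosedFieldType) := Univariate {
  act :> (C -> C) -> C;
  act_linear : forall (a : C) (f g : C -> C), laurent f -> laurent g ->
    act (fun z => a * f z + g z) = a * act f + act g;
  act_ext : forall f g : C -> C, laurent f -> laurent g ->
    (forall z, z != 0 -> f z = g z) -> act f = act g
}.

Definition chi (C : numClosedFieldType) (k : nat) (z : C) : C :=
  if odd k then z ^- (k.+1)./2 else z ^+ k./2.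

Definition gram (C : numClosedFieldType) (b : (C -> C) -> (C -> C) -> C)
    (k l : nat) : C :=
  b (chi k) (chi l).

Definition quasidefinite (C : numClosedFieldType) (G : nat -> nat -> C) : Prop :=
  forall k, \det (\matrix_(i < k, j < k) G i j) != 0.

Definition lower_unitriangular (C : numClosedFieldType) (S : nat -> nat -> C) : Prop :=
  forall i j, (i <= j)%N -> S i j = (i == j)%:R.

(* T S = I for lower triangular T. *)
Definition lower_mul_id (C : numClosedFieldType) (T S : nat -> nat -> C) : Prop :=
  forall i j, \sum_(k < i.+1) T i k * S k j = (i == j)%:R.

(* The factorization G = S1^-1 H (S2^-1)^dagger of a semi-infinite matrix. *)
Record gauss_borel (C : numClosedFieldType) (G : nat -> nat -> C) := GaussBorel {
  gS1 : nat -> nat -> C;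
  gS1inv : nat -> nat -> C;
  gH : nat -> C;
  gS2 : nat -> nat -> C;
  gS2inv : nat -> nat -> C;
  gS1_lower : lower_unitriangular gS1;
  gS1inv_lower : lower_unitriangular gS1inv;
  gS2_lower : lower_unitriangular gS2;
  gS2inv_lower : lower_unitriangular gS2inv;
  gS1_mulVm : lower_mul_id gS1inv gS1;
  gS1_mulmV : lower_mul_id gS1 gS1inv;
  gS2_mulVm : lower_mul_id gS2inv gS2;
  gS2_mulmV : lower_mul_id gS2 gS2inv;
  gE : forall k l,
    G k l = \sum_(i < (minn k l).+1) gS1inv k i * gH i * (gS2inv l i)^*
}.

Definition phi1 (C : numClosedFieldType) (G : nat -> nat -> C) (X : gauss_borel G)
    (k : nat) (z : C) : C :=
  \sum_(j < k.+1) gS1 X k j * chi j z.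

Definition phi2 (C : numClosedFieldType) (G : nat -> nat -> C) (X : gauss_borel G)
    (k : nat) (z : C) : C :=
  \sum_(j < k.+1) gS2 X k j * chi j z.

(* CDkernel X l z1 z2 is K^[l](\bar z1, z2): the first argument is passed
   unconjugated, here and in the mixed kernels. *)
Definition CDkernel (C : numClosedFieldType) (G : nat -> nat -> C) (X : gauss_borel G)
    (l : nat) (z1 z2 : C) : C :=
  \sum_(k < l) (phi2 X k z1)^* * (gH X k)^-1 * phi1 X k z2.

Definition cauchy1 (C : numClosedFieldType) (u : bivariate C)
    (X : gauss_borel (gram (pair u))) (k : nat) (z : C) : C :=
  pair u (phi1 X k) (fun z2 => (z^* - z2)^-1).

Definition cauchy2 (C : numClosedFieldType) (u : bivariate C)
    (X : gauss_borel (gram (pair u))) (k : nat) (z : C) : C :=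
  (pair u (fun z1 => (z^* - z1)^-1) (phi2 X k))^*.

Definition mixed_Cphi (C : numClosedFieldType) (u : bivariate C)
    (X : gauss_borel (gram (pair u))) (l : nat) (z1 z2 : C) : C :=
  \sum_(k < l) (cauchy2 X k z1)^* * (gH X k)^-1 * phi1 X k z2.

Definition mixed_phiC (C : numClosedFieldType) (u : bivariate C)
    (X : gauss_borel (gram (pair u))) (l : nat) (z1 z2 : C) : C :=
  \sum_(k < l) (phi2 X k z1)^* * (gH X k)^-1 * cauchy1 X k z2.

(* The polynomial z^n L(z), for L = sum_(-n <= j <= n) c_j z^j. *)
Definition laurent_num (C : numClosedFieldType) (n : nat) (c : int -> C) : {poly C} :=
  \poly_(j < (2 * n).+1) c (j%:Z - n%:Z).

(* A Laurent polynomial with nonzero coefficients of z^n and z^-n, together with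
   the list without repetition of its zeros in C^* and their multiplicities. *)
Record prepared (C : numClosedFieldType) (n : nat) := Prepared {
  lcoef : int -> C;
  nzeros : nat;
  zeta : 'I_nzeros -> C;
  mult : 'I_nzeros -> nat;
  lcoef_neq0 : lcoef n%:Z * lcoef (- n%:Z) != 0;
  zeta_inj : injective zeta;
  zeta_neq0 : forall i, zeta i != 0;
  mult_gt0 : forall i, (0 < mult i)%N;
  zeta_mult : forall i, mup (zeta i) (laurent_num n lcoef) = mult i;
  zeta_all : forall z, z != 0 -> root (laurent_num n lcoef) z -> exists i, z = zeta i
}.

Arguments zeta {C n} p i.
Arguments mult {C n} p i.

Definition leval (C : numClosedFieldType) (n : nat) (L : prepared C n) (z : C) : C :=
  \sum_(j < (2 * n).+1) lcoef L (j%:Z - n%:Z) * z ^ (j%:Z - n%:Z).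

Definition sigma (C : numClosedFieldType) (n : nat) (L : prepared C n) : set C :=
  [set z | z != 0 /\ leval L z = 0].

Lemma levalE (C : numClosedFieldType) (n : nat) (L : prepared C n) (z : C) :
  z != 0 -> leval L z = (laurent_num n (lcoef L)).[z] / z ^+ n.
Proof.
move=> z0; rewrite horner_poly mulr_suml; apply: eq_bigr => j _.
by rewrite -mulrA expfzDr// exprnN.
Qed.

(* The length of the jets below, which is 2n by nmultE. *)
Definition nmult (C : numClosedFieldType) (n : nat) (L : prepared C n) : nat :=
  (\sum_(i < nzeros L) mult L i)%N.

Lemma nmultE (C : numClosedFieldType) (n : nat) (L : prepared C n) :
  nmult L = (2 * n)%N.
Proof.
set p := laurent_num n (lcoef L).
have [cn0 cN0] : lcoef L n%:Z != 0 /\ lcoef L (- n%:Z) != 0.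
  by apply/andP; rewrite -negb_or -mulf_eq0 lcoef_neq0.
have sp : size p = (2 * n).+1.
  by apply: size_poly_eq; rewrite /= mul2n -addnn PoszD addrK.
have p00 : p`_0 != 0 by rewrite coef_poly /= sub0r.
have [r rP] := closed_field_poly_normal p.
have lp0 : lead_coef p != 0 by rewrite lead_coef_eq0 -size_poly_eq0 sp.
have sr : size r = (2 * n)%N.
  by move: sp; rewrite rP size_scale// size_prod_XsubC => -[].
have cnt i : mult L i = count_mem (zeta L i) r.
  rewrite -zeta_mult -/p rP -mul_polyC mupMr ?mu_prod_XsubC//.
  by rewrite rootC.
have -> : nmult L = (\sum_(i < nzeros L) \sum_(x <- r) (x == zeta L i : nat))%N.
  apply: eq_bigr => i _; rewrite cnt -sum1_count big_mkcond.
  by apply: eq_bigr => x _ /=; case: eqP.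
rewrite exchange_big /= -sr -sum1_size !big_seq; apply: eq_bigr => x xr.
have rx : root p x by rewrite rP rootZ// root_prod_XsubC.
have x0 : x != 0.
  by apply: contraNneq p00 => x0; rewrite -horner_coef0 -[X in _.[X]]x0; exact: rx.
have [i xi] := zeta_all x0 rx.
rewrite (bigD1 i)//= xi eqxx big1 ?addn0// => j ji.
by rewrite (inj_eq (@zeta_inj _ _ L)) eq_sym (negbTE ji).
Qed.

Definition masses (C : numClosedFieldType) (n : nat) (L : prepared C n) : Type :=
  forall i : 'I_(nzeros L), 'I_(mult L i) -> univariate C.

Definition geronimus1 (C : numClosedFieldType) (u : bivariate C) (n : nat)
    (L : prepared C n) (xi : masses L) (f g : C -> C) : C :=
  pair u (fun z => f z / leval L z) g +
  \sum_(i < nzeros L) \sum_(r < mult L i)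
    (r`!%:R)^-1 * derive1n r f (zeta L i) * (xi i r g)^*.

Definition geronimus2 (C : numClosedFieldType) (u : bivariate C) (n : nat)
    (L : prepared C n) (xi : masses L) (f g : C -> C) : C :=
  pair u f (fun z => g z / leval L z) +
  \sum_(i < nzeros L) \sum_(r < mult L i)
    (r`!%:R)^-1 * xi i r f * (derive1n r g (zeta L i))^*.

Definition jet (C : numClosedFieldType) (n : nat) (L : prepared C n) (f : C -> C) :
    'rV[C]_(nmult L) :=
  \mxrow_(i < nzeros L) \row_(r < mult L i) (derive1n r f (zeta L i) / r`!%:R).

(* The jet at the zeros of the Laurent polynomial with conjugated coefficients. *)
Definition jet_bar (C : numClosedFieldType) (n : nat) (L : prepared C n) (f : C -> C) :
    'rV[C]_(nmult L) :=
  \mxrow_(i < nzeros L) \row_(r < mult L i) (derive1n r f (zeta L i)^* / r`!%:R).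

Definition act_row (C : numClosedFieldType) (n : nat) (L : prepared C n)
    (xi : masses L) (f : C -> C) : 'rV[C]_(nmult L) :=
  \mxrow_(i < nzeros L) \row_(r < mult L i) xi i r f.

Definition bar (C : numClosedFieldType) (f : C -> C) (z : C) : C := (f z^*)^*.

Definition lremove (C : numClosedFieldType) (n : nat) (L : prepared C n)
    (j : 'I_(nzeros L)) (z : C) : C :=
  lcoef L n%:Z * z ^- n * \prod_(i < nzeros L | i != j) (z - zeta L i) ^+ mult L i.

Definition ell (C : numClosedFieldType) (n : nat) (L : prepared C n)
    (j : 'I_(nzeros L)) (k : nat) : C :=
  (k`!%:R)^-1 * derive1n k (bar (lremove j)) (zeta L j)^*.

Definition Lblock (C : numClosedFieldType) (n : nat) (L : prepared C n)
    (j : 'I_(nzeros L)) : 'M[C]_(mult L j) :=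
  \matrix_(p < mult L j, q < mult L j)
    if (mult L j <= (p + q).+1)%N then ell j ((p + q).+1 - mult L j) else 0.

Definition Lmatrix (C : numClosedFieldType) (n : nat) (L : prepared C n) :
    'M[C]_(nmult L) :=
  \mxdiag_(j < nzeros L) Lblock j.

(* (L(x) - L(y)) / (x - y), as a Laurent polynomial in x and y: on the diagonal
   the removable singularity is filled in. *)
Definition deltaL (C : numClosedFieldType) (n : nat) (L : prepared C n) (x y : C) : C :=
  if x == y then derive1 (leval L) x else (leval L x - leval L y) / (x - y).

Definition Arow (C : numClosedFieldType) (u : bivariate C)
    (X : gauss_borel (gram (pair u))) (n : nat) (L : prepared C n) (xi : masses L)
    (k : nat) : 'rV[C]_(nmult L) :=
  jet_bar L (cauchy1 X k) - act_row xi (phi1 X k) *m Lmatrix L.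

Definition Brow (C : numClosedFieldType) (u : bivariate C)
    (X : gauss_borel (gram (pair u))) (n : nat) (L : prepared C n) (xi : masses L)
    (k : nat) : 'rV[C]_(nmult L) :=
  jet_bar L (cauchy2 X k) - act_row xi (phi2 X k) *m Lmatrix L.

Definition Rrow2 (C : numClosedFieldType) (u : bivariate C)
    (X : gauss_borel (gram (pair u))) (n : nat) (L : prepared C n) (xi : masses L)
    (l : nat) (z : C) : 'rV[C]_(nmult L) :=
  (leval L z)^* *:
    (jet_bar L (fun x => mixed_phiC X l z x)
     - act_row xi (fun x => CDkernel X l z x) *m Lmatrix L)
  + map_mx Num.conj (jet L (fun x => deltaL L x z)).

Definition Rrow1 (C : numClosedFieldType) (u : bivariate C)
    (X : gauss_borel (gram (pair u))) (n : nat) (L : prepared C n) (xi : masses L)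
    (l : nat) (z : C) : 'rV[C]_(nmult L) :=
  (leval L z)^* *:
    (jet_bar L (fun x => (mixed_Cphi X l x z)^*)
     - act_row xi (fun x => (CDkernel X l x z)^*) *m Lmatrix L)
  + map_mx Num.conj (jet L (fun x => deltaL L x z)).

(* The square matrix with rows A_s, A_(s+1), ... *)
Definition window (C : numClosedFieldType) (N : nat) (A : nat -> 'rV[C]_N) (s : nat) :
    'M[C]_N :=
  \matrix_(i < N) A (s + i)%N.

(* The square matrix with rows A_s, ..., A_(s+N-2), r. *)
Definition window_last (C : numClosedFieldType) (N : nat) (A : nat -> 'rV[C]_N)
    (s : nat) (r : 'rV[C]_N) : 'M[C]_N :=
  \matrix_(i < N) if i.+1 == N then r else A (s + i)%N.

(* The last quasideterminant of [A, B; c, d]. *)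
Definition Theta (C : numClosedFieldType) (N : nat) (A : 'M[C]_N) (B : 'cV[C]_N)
    (c : 'rV[C]_N) (d : C) : C :=
  d - (c *m invmx A *m B) ord0 ord0.

Definition first_col (C : numClosedFieldType) (N : nat) : 'cV[C]_N :=
  \col_(i < N) (i == 0%N :> nat)%:R.

Arguments first_col : clear implicits.

(* Main.v *)
Require Import Defs.
From HB Require Import structures.
From mathcomp Require Import all_boot all_order all_algebra.
From mathcomp Require Import complex.
From mathcomp Require Import all_classical all_reals all_analysis.
From mathcomp Require Import zify ring.

(** Let [B] be the pairing of [u], [Bc] the one of its second Geronimus
    transformation, so that [Bc f (L g) = B f g], and let [s = l - 2 n].

    Multiplication by [L] raises the CMV index by exactly [2 n].  Hence the
    difference between the transformed [phi1] of index [l] and the old one, which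
    is below index [l], is [B]-orthogonal to [phi2] of index [k < s], and is a
    combination of [phi1] of indices [s], ..., [l - 1] only ([phi1_tail]); its
    coefficient at [s] is the new norm times the conjugate of the leading
    coefficient of [L], divided by the old norm ([increment_head]).  To determine
    the coefficients, test against the [2 n] partial quotients
    [L(z) / (z - zeta_i)^(r+1)].  They lie below CMV index [2 n <= l], so the
    transformed [phi1] is orthogonal to them.  On the other hand their pairings
    under [Bc] with any Laurent polynomial [f] are, up to sign, the jet of the
    Cauchy transform of [f] minus the mass term: divided by [L] they are powers of
    [(z - zeta_i)^-1], which are derivatives of Cauchy kernels, and their own jets
    at the zeros of [L] are the entries of the block matrix ([cauchy_rowE]).  The
    equations thus have the rows [A] as coefficients, and solving them gives the
    formulas for [phi1] and [H] as quasideterminants.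

    The same argument applies, for fixed [z], to the difference between the
    Christoffel-Darboux kernel of [Bc] and the conjugate of [L(z)] times that of
    [B]: the reproducing property of both kernels shows that it is orthogonal to
    [phi2] of index [k < s] and that its coefficient at [s] contains the
    transformed [phi2] of index [l] at [z] ([defect_head]).  Its pairings with the
    partial quotients form the row [R], in which the conjugated jet of [deltaL]
    is what the kernel of [Bc] reproduces ([remainder_rowE]).

    The other Geronimus transformation is the same one for the form with the two
    variables exchanged ([swap]). *)

Set Implicit Arguments.
Unset Strict Implicit.
Unset Printing Implicit Defensive.

Import Order.TTheory GRing.Theory Num.Theory.
Import numFieldNormedType.Exports.

Local Open Scope classical_set_scope.
Local Open Scope ring_scope.

(** * Laurent polynomials and the CMV filtration *)

Section Laurent.
Variable C : numClosedFieldType.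
Implicit Types (f g : C -> C) (k : nat).

Lemma laurent_ext f g :
  laurent f -> (forall z, z != 0 -> g z = f z) -> laurent g.
Proof. by move=> [p [N h]] gf; exists p, N => z z0; rewrite gf// h. Qed.

Lemma laurent_poly (p : {poly C}) : laurent (horner p).
Proof. by exists p, 0%N => z _; rewrite expr0 divr1. Qed.

Lemma laurentD f g : laurent f -> laurent g -> laurent (fun z => f z + g z).
Proof.
move=> [p [N hp]] [q [M hq]]; exists (p * 'X^M + q * 'X^N), (N + M)%N => z z0.
have zN k : z ^+ k != 0 by rewrite expf_neq0.
by rewrite hp// hq// addf_div// !hornerE exprD.
Qed.

Lemma laurentM f g : laurent f -> laurent g -> laurent (fun z => f z * g z).
Proof.
move=> [p [N hp]] [q [M hq]]; exists (p * q), (N + M)%N => z z0.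
by rewrite hp// hq// mulf_div hornerM exprD.
Qed.

Lemma laurentZ (a : C) f : laurent f -> laurent (fun z => a * f z).
Proof.
move=> lf; apply: laurentM lf.
by apply: (laurent_ext (laurent_poly a%:P)) => z _; rewrite hornerC.
Qed.

Lemma laurentL (a : C) f g :
  laurent f -> laurent g -> laurent (fun z => a * f z + g z).
Proof. by move=> lf lg; apply: laurentD => //; exact: laurentZ. Qed.

Lemma laurent_sum (I : Type) (r : seq I) (P : pred I) (F : I -> C -> C) :
  (forall i, laurent (F i)) -> laurent (fun z => \sum_(i <- r | P i) F i z).
Proof.
move=> h; elim: r => [|i r IHr].
  by apply: (laurent_ext (laurent_poly 0)) => z _; rewrite big_nil horner0.
have [Pi|Pi] := boolP (P i).
  by apply: (laurent_ext (laurentD (h i) IHr)) => z _; rewrite big_cons Pi.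
by apply: (laurent_ext IHr) => z _; rewrite big_cons (negbTE Pi).
Qed.

Lemma laurent_exp (e : int) : laurent (fun z : C => z ^ e).
Proof.
case: e => k.
  by exists 'X^k, 0%N => z z0; rewrite expr0 divr1 hornerXn.
by exists 1, k.+1 => z z0; rewrite hornerC mul1r NegzE exprnN.
Qed.

Lemma chiE k (z : C) :
  chi k z = z ^ (if odd k then - ((k.+1)./2)%:Z else (k./2)%:Z).
Proof. by rewrite /chi; case: odd => //; rewrite exprnN. Qed.

Lemma laurent_chi k : laurent (@chi C k).
Proof. by apply: (laurent_ext (laurent_exp _)) => z _; rewrite chiE. Qed.

(** Membership is tested on the punctured plane only: the value that a function
    takes at [0] has no meaning for Laurent polynomials. *)
Definition cmv_span k f : Prop :=
  exists c : nat -> C, forall z, z != 0 -> f z = \sum_(j < k) c j * chi j z.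

Lemma cmv_span_ext k f g :
  cmv_span k f -> (forall z, z != 0 -> g z = f z) -> cmv_span k g.
Proof. by move=> [c h] gf; exists c => z z0; rewrite gf// h. Qed.

Lemma cmv_span_laurent k f : cmv_span k f -> laurent f.
Proof.
move=> [c h]; apply: (laurent_ext _ h).
by apply: laurent_sum => j; apply: laurentZ; exact: laurent_chi.
Qed.

Lemma cmv_span_le k K f : (k <= K)%N -> cmv_span k f -> cmv_span K f.
Proof.
move=> kK [c h]; exists (fun j => if (j < k)%N then c j else 0) => z z0.
rewrite h// (big_ord_widen _ (fun j => c j * chi j z) kK) big_mkcond /=.
by apply: eq_bigr => j _; case: ifP; rewrite ?mul0r.
Qed.

Lemma cmv_spanL k (a : C) f g :
  cmv_span k f -> cmv_span k g -> cmv_span k (fun z => a * f z + g z).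
Proof.
move=> [c hf] [d hg]; exists (fun j => a * c j + d j) => z z0.
rewrite hf// hg// mulr_sumr -big_split /=; apply: eq_bigr => j _.
by rewrite mulrDl mulrA.
Qed.

Lemma cmv_span0 k : cmv_span k (fun=> 0).
Proof. by exists (fun=> 0) => z _; rewrite big1// => j _; rewrite mul0r. Qed.

Lemma cmv_spanZ k (a : C) f : cmv_span k f -> cmv_span k (fun z => a * f z).
Proof.
move=> hf; apply: (cmv_span_ext (cmv_spanL a hf (cmv_span0 k))) => z _.
by rewrite addr0.
Qed.

Lemma cmv_spanB k f g :
  cmv_span k f -> cmv_span k g -> cmv_span k (fun z => f z - g z).
Proof.
move=> hf hg; apply: (cmv_span_ext (cmv_spanL (-1) hg hf)) => z _.
by rewrite mulN1r addrC.
Qed.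

Lemma cmv_span_sum k (I : Type) (r : seq I) (P : pred I) (F : I -> C -> C) :
  (forall i, P i -> cmv_span k (F i)) ->
  cmv_span k (fun z => \sum_(i <- r | P i) F i z).
Proof.
move=> h; elim: r => [|i r IHr].
  by apply: (cmv_span_ext (cmv_span0 k)) => z _; rewrite big_nil.
have [Pi|Pi] := boolP (P i).
  apply: (cmv_span_ext (cmv_spanL 1 (h _ Pi) IHr)) => z _.
  by rewrite big_cons Pi mul1r.
by apply: (cmv_span_ext IHr) => z _; rewrite big_cons (negbTE Pi).
Qed.

Lemma cmv_span_chi k K : (k < K)%N -> cmv_span K (@chi C k).
Proof.
move=> kK; exists (fun j => (j == k)%:R) => z z0.
rewrite (bigD1 (Ordinal kK))//= eqxx mul1r big1 ?addr0// => j.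
by rewrite -val_eqE /= => /negbTE ->; rewrite mul0r.
Qed.

(** In the CMV sequence the power [z ^ e] has index [2 * e] if [e >= 0] and
    [- 2 * e - 1] otherwise. *)
Lemma cmv_span_exp K (e : int) : e *+ 2 < K%:Z -> - e *+ 2 <= K%:Z ->
  cmv_span K (fun z : C => z ^ e).
Proof.
move=> h1 h2; have [e0|e0] := leP 0 e.
  apply: (cmv_span_ext (@cmv_span_chi (`|e|%N).*2 K _)); first by lia.
  move=> z z0; rewrite chiE odd_double doubleK; congr (z ^ _); lia.
apply: (cmv_span_ext (@cmv_span_chi (`|e|%N).*2.-1 K _)); first by lia.
move=> z z0; rewrite chiE; have -> : odd (`|e|%N).*2.-1 by lia.
congr (z ^ _); lia.
Qed.

End Laurent.

(** * Biorthogonality and reproducing kernels *)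

Section Form.
Variable C : numClosedFieldType.
Implicit Types (B : (C -> C) -> (C -> C) -> C) (f g : C -> C).

(** Only Laurent polynomials are tested, so that both a functional given on
    rational functions and its Geronimus transformation, whose masses act on
    Laurent polynomials only, are instances. *)
Record sesquilinear_form B : Prop := SesquilinearForm {
  form_linear : forall (a : C) f f' g, laurent f -> laurent f' -> laurent g ->
    B (fun z => a * f z + f' z) g = a * B f g + B f' g;
  form_antilinear : forall (a : C) f g g',
    laurent f -> laurent g -> laurent g' ->
    B f (fun z => a * g z + g' z) = a^* * B f g + B f g';
  form_ext : forall f f' g g', laurent f -> laurent f' -> laurent g ->
    laurent g' -> (forall z, z != 0 -> f z = f' z) ->
    (forall z, z != 0 -> g z = g' z) -> B f g = B f' g'
}.

(** Exchanging the two variables exchanges [phi1] with [phi2] and the two kinds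
    of Geronimus transformation, and conjugates the norms.  Every statement on
    one variable thus yields its twin on the other one. *)
Definition swap B f g : C := (B g f)^*.

Lemma swap_form B : sesquilinear_form B -> sesquilinear_form (swap B).
Proof.
move=> [l1 l2 ex]; split; rewrite /swap.
- by move=> a f f' g hf hf' hg; rewrite l2// rmorphD rmorphM /= conjCK.
- by move=> a f f' g hf hf' hg; rewrite l1// rmorphD rmorphM.
- by move=> f f' g g' hf hf' hg hg' e1 e2; congr (_ ^*); exact: ex.
Qed.

Section SwapBorel.
Variable B : (C -> C) -> (C -> C) -> C.
Variable X : gauss_borel (gram B).

Lemma swap_borel_subproof k l : gram (swap B) k l =
  \sum_(i < (minn k l).+1) gS2inv X k i * (gH X i)^* * (gS1inv X l i)^*.
Proof.
rewrite /gram /swap [B _ _](gE X) minnC rmorph_sum; apply: eq_bigr => i _.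
by rewrite !rmorphM /= conjCK mulrC [_^* * _]mulrC mulrA.
Qed.

Definition swap_borel : gauss_borel (gram (swap B)) :=
  @GaussBorel C _ (gS2 X) (gS2inv X) (fun k => (gH X k)^*) (gS1 X) (gS1inv X)
    (gS2_lower X) (gS2inv_lower X) (gS1_lower X) (gS1inv_lower X)
    (gS2_mulVm X) (gS2_mulmV X) (gS1_mulVm X) (gS1_mulmV X)
    swap_borel_subproof.

End SwapBorel.

Lemma swap_quasidefinite B :
  quasidefinite (gram B) -> quasidefinite (gram (swap B)).
Proof.
move=> h k; have := h k; rewrite -det_tr -conjC_eq0 -det_map_mx.
by apply: contra; congr (\det _ == 0); apply/matrixP => i j; rewrite !mxE.
Qed.

Lemma laurent0 : laurent (fun=> 0 : C).
Proof. exact: cmv_span_laurent (cmv_span0 C 0). Qed.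

Lemma laurent_functional_sum (F : (C -> C) -> C)
    (Flin : forall (a : C) f g, laurent f -> laurent g ->
      F (fun z => a * f z + g z) = a * F f + F g)
    (Fext : forall f g, laurent f -> laurent g ->
      (forall z, z != 0 -> f z = g z) -> F f = F g)
    K (c : 'I_K -> C) (f : 'I_K -> C -> C) : (forall i, laurent (f i)) ->
  F (fun z => \sum_i c i * f i z) = \sum_i c i * F (f i).
Proof.
move=> lf.
have F0 : F (fun=> 0) = 0.
  have l0 := laurent0; have := Flin (-1) _ _ l0 l0.
  rewrite (mulN1r (F _)) addNr => E; rewrite -[RHS]E.
  by apply: Fext => //; [exact: (laurentL (-1) l0 l0)|move=> z _; rewrite mulr0 addr0].
suff H (r : seq 'I_K) :
    F (fun z => \sum_(i <- r) c i * f i z) = \sum_(i <- r) c i * F (f i).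
  exact: H.
have ls s : laurent (fun z => \sum_(i <- s) c i * f i z).
  by apply: laurent_sum => i; exact: laurentZ.
elim: r => [|i r IHr].
  rewrite big_nil -[RHS]F0; apply: Fext => //; first exact: laurent0.
  by move=> z _; rewrite big_nil.
rewrite big_cons -IHr -Flin//; apply: Fext => //.
  exact: laurentL.
by move=> z _; rewrite big_cons.
Qed.

Section Expansion.
Variable B : (C -> C) -> (C -> C) -> C.
Hypothesis Bform : sesquilinear_form B.

Lemma form_suml K (c : 'I_K -> C) (F : 'I_K -> C -> C) g :
  (forall i, laurent (F i)) -> laurent g ->
  B (fun z => \sum_i c i * F i z) g = \sum_i c i * B (F i) g.
Proof.
move=> hF hg; apply: (laurent_functional_sum (F := B^~ g)) hF.
  by move=> a f f' hf hf'; exact: form_linear.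
by move=> f f' hf hf' ff'; exact: form_ext.
Qed.

Lemma form_subl f f' g : laurent f -> laurent f' -> laurent g ->
  B (fun z => f z - f' z) g = B f g - B f' g.
Proof.
move=> hf hf' hg; have := form_linear Bform (-1) hf' hf hg.
rewrite (mulN1r (B f' g)) (addrC (- B f' g)) => <-; apply: (form_ext Bform) => //.
- by apply: (laurent_ext (laurentL (-1) hf' hf)) => z _; rewrite mulN1r addrC.
- exact: laurentL.
- by move=> z _; rewrite mulN1r addrC.
Qed.

End Expansion.

Lemma form_sumr B : sesquilinear_form B -> forall K (c : 'I_K -> C)
    (F : 'I_K -> C -> C) f,
  (forall i, laurent (F i)) -> laurent f ->
  B f (fun z => \sum_i c i * F i z) = \sum_i (c i)^* * B f (F i).
Proof.
move=> hB K c F f hF hf; have := form_suml (swap_form hB) c hF hf.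
move=> /(congr1 Num.conj); rewrite conjCK => ->; rewrite rmorph_sum.
by apply: eq_bigr => i _; rewrite rmorphM /= conjCK.
Qed.

Section Biorthogonal.
Variable B : (C -> C) -> (C -> C) -> C.
Hypothesis Bform : sesquilinear_form B.
Variable X : gauss_borel (gram B).

Lemma phi1_span k : cmv_span k.+1 (phi1 X k).
Proof. by exists (gS1 X k). Qed.

Lemma phi1_laurent k : laurent (phi1 X k).
Proof. exact: cmv_span_laurent (phi1_span k). Qed.

Lemma phi1_monic k : cmv_span k (fun z => phi1 X k z - chi k z).
Proof.
exists (gS1 X k) => z z0.
by rewrite /phi1 big_ord_recr /= (gS1_lower X) ?eqxx// mul1r addrK.
Qed.

(** Read [G = S1^-1 H (S2^-1)^dagger] as [S1 G = H (S2^-1)^dagger]: the right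
    hand side is upper triangular.  All orthogonality relations follow. *)
Lemma phi1_chi k j :
  B (phi1 X k) (chi j) = if (k <= j)%N then gH X k * (gS2inv X j k)^* else 0.
Proof.
rewrite form_suml//; [|by move=> i; exact: laurent_chi|exact: laurent_chi].
transitivity (\sum_(i < k.+1) \sum_(m < j.+1)
    gS1 X k i * gS1inv X i m * (gH X m * (gS2inv X j m)^*)).
  apply: eq_bigr => i _; rewrite [B _ _](gE X) mulr_sumr.
  have hm : ((minn i j).+1 <= j.+1)%N by rewrite ltnS geq_minr.
  rewrite (big_ord_widen _ (fun m => gS1 X k i *
    (gS1inv X i m * gH X m * (gS2inv X j m)^*)) hm) big_mkcond.
  apply: eq_bigr => m _; case: ifP => [_|]; rewrite -?mulrA//.
  move=> /negbT; rewrite -leqNgt => hm'.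
  have im : (i < m)%N by have := ltn_ord m; lia.
  by rewrite (gS1inv_lower X (ltnW im)) (ltn_eqF im) !(mul0r, mulr0).
rewrite exchange_big /=.
under eq_bigr => m _ do rewrite -mulr_suml (gS1_mulmV X).
case: ifP => kj.
  rewrite (bigD1 (Ordinal (kj : (k < j.+1)%N)))//= eqxx mul1r big1 ?addr0//.
  by move=> m; rewrite -val_eqE /= eq_sym => /negbTE ->; rewrite mul0r.
apply: big1 => m _; have -> : (k == m) = false by have := ltn_ord m; lia.
by rewrite mul0r.
Qed.

Lemma phi1_orth k g : cmv_span k g -> B (phi1 X k) g = 0.
Proof.
move=> hg; have [c gE] := hg.
have lg := cmv_span_laurent hg.
have lc (j : 'I_k) : laurent (@chi C j) by exact: laurent_chi.
rewrite (form_ext Bform (phi1_laurent k) (phi1_laurent k) lg _ _ gE)//; last first.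
  by apply: laurent_sum => j; apply: laurentZ.
rewrite (form_sumr Bform)//; last exact: phi1_laurent.
by apply: big1 => j _; rewrite phi1_chi leqNgt ltn_ord mulr0.
Qed.

(** A zero norm would make a row of [S1] a left null vector of a leading block
    of the Gram matrix. *)
Lemma gH_neq0 : quasidefinite (gram B) -> forall k, gH X k != 0.
Proof.
move=> qd k; apply/eqP => Hk0; have := qd k.+1.
set M := \matrix_(_, _) _; rewrite -unitfE -/(M \in unitmx) => Mu.
pose v : 'rV[C]_k.+1 := \row_i gS1 X k i.
have v0 : v *m M = 0.
  apply/rowP => j; rewrite !mxE.
  transitivity (B (phi1 X k) (chi j)).
    rewrite form_suml//; [|by move=> i; exact: laurent_chi|exact: laurent_chi].
    by apply: eq_bigr => i _; rewrite !mxE.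
  by rewrite phi1_chi Hk0 mul0r; case: ifP.
have := congr1 (mulmx^~ (invmx M)) v0; rewrite mul0mx mulmxK// => /rowP/(_ ord_max).
by rewrite !mxE (gS1_lower X)// eqxx => /eqP; rewrite oner_eq0.
Qed.

End Biorthogonal.

Section Biorthogonal2.
Variable B : (C -> C) -> (C -> C) -> C.
Hypothesis Bform : sesquilinear_form B.
Variable X : gauss_borel (gram B).

Lemma phi2_span k : cmv_span k.+1 (phi2 X k).
Proof. exact: phi1_span (swap_borel X) k. Qed.

Lemma phi2_laurent k : laurent (phi2 X k).
Proof. exact: phi1_laurent (swap_borel X) k. Qed.

Lemma phi2_monic k : cmv_span k (fun z => phi2 X k z - chi k z).
Proof. exact: phi1_monic (swap_borel X) k. Qed.

Lemma phi2_orth k f : cmv_span k f -> B f (phi2 X k) = 0.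
Proof.
move=> /(phi1_orth (swap_form Bform) (swap_borel X))/eqP.
by rewrite conjC_eq0 => /eqP.
Qed.

Lemma phi_norm k : B (phi1 X k) (phi2 X k) = gH X k.
Proof.
have lc : laurent (@chi C k) := laurent_chi C k.
have l2 := phi2_laurent k; have l1 := phi1_laurent X k.
have := form_antilinear Bform (-1) l1 lc l2.
rewrite (phi1_chi Bform) leqnn (gS2inv_lower X)// eqxx rmorph1 mulr1 => E.
have : B (phi1 X k) (fun z => -1 * chi k z + phi2 X k z) = 0.
  apply: (phi1_orth Bform); apply: (cmv_span_ext (phi2_monic k)) => z _.
  by rewrite mulN1r addrC.
by rewrite E rmorphN rmorph1 mulN1r => /eqP; rewrite addrC subr_eq0 => /eqP.
Qed.

Lemma biorthogonality j k : B (phi1 X j) (phi2 X k) = (j == k)%:R * gH X k.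
Proof.
case: ltngtP => [jk|kj|->]; last by rewrite mul1r phi_norm.
  by rewrite mul0r phi2_orth//; exact: cmv_span_le (phi1_span X j).
by rewrite mul0r (phi1_orth Bform)//; exact: cmv_span_le (phi2_span k).
Qed.

End Biorthogonal2.

Section Reproducing.
Variable B : (C -> C) -> (C -> C) -> C.
Hypothesis Bform : sesquilinear_form B.
Variable X : gauss_borel (gram B).
Hypothesis Bqd : quasidefinite (gram B).

Let H0 := gH_neq0 Bform X Bqd.

(** Subtracting the right multiple of the last [phi1] lowers the span. *)
Lemma phi1_basis K f : cmv_span K f ->
  exists c : nat -> C, forall z, z != 0 -> f z = \sum_(j < K) c j * phi1 X j z.
Proof.
elim: K f => [|K IHK] f [c fE].
  by exists c => z z0; rewrite fE// !big_ord0.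
have : cmv_span K (fun z => f z - c K * phi1 X K z).
  have hc : cmv_span K (fun z => \sum_(j < K) c j * chi j z) by exists c.
  apply: (cmv_span_ext (cmv_spanL (- c K) (phi1_monic X K) hc)) => z z0.
  by rewrite fE// big_ord_recr /= mulNr mulrBr opprB -addrA addrC.
move=> /IHK[d dE]; exists (fun j => if j == K then c K else d j) => z z0.
rewrite big_ord_recr /= eqxx; apply/eqP; rewrite -subr_eq dE//; apply/eqP.
by apply: eq_bigr => j _; rewrite ltn_eqF.
Qed.

Lemma phi1_expansion K f z : cmv_span K f -> z != 0 ->
  f z = \sum_(j < K) B f (phi2 X j) / gH X j * phi1 X j z.
Proof.
move=> hf z0; have [c cE] := phi1_basis hf.
rewrite cE//; apply: eq_bigr => k _; congr (_ * _).
have lp (i : 'I_K) : laurent (phi1 X i) := phi1_laurent X i.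
rewrite (form_ext Bform (cmv_span_laurent hf) _ (phi2_laurent X k)
  (phi2_laurent X k) cE)//; last first.
  by apply: laurent_sum => j; apply: laurentZ.
rewrite (form_suml Bform)//; last exact: phi2_laurent.
rewrite (bigD1 k)//= biorthogonality// eqxx mul1r big1 ?addr0 ?mulfK//.
by move=> j; rewrite -val_eqE biorthogonality// => /negbTE ->; rewrite mul0r mulr0.
Qed.

(** This bounds the number of terms in the connection formulas: the functions
    to which it is applied are orthogonal to all but the last [2 n] of the
    [phi2]. *)
Lemma phi1_tail s N f : cmv_span (s + N) f ->
  (forall k, (k < s)%N -> B f (phi2 X k) = 0) ->
  forall z, z != 0 -> f z =
    \sum_(i < N) B f (phi2 X (s + i)) / gH X (s + i) * phi1 X (s + i) z.
Proof.
move=> hf f0 z z0; rewrite (phi1_expansion hf z0) big_split_ord /=.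
by rewrite big1 ?add0r// => k _; rewrite f0// !mul0r.
Qed.

Lemma kernel_span K z : cmv_span K (CDkernel X K z).
Proof.
apply: cmv_span_sum => k _; apply: cmv_spanZ.
exact: cmv_span_le (phi1_span X k).
Qed.

End Reproducing.

(** The coefficients of [g] in the basis [phi2] are given by the expansion for
    the swapped form; conjugating them moves the sum into the first slot. *)
Lemma kernel_reproducing B (Bform : sesquilinear_form B)
    (X : gauss_borel (gram B)) (Bqd : quasidefinite (gram B)) K g z :
  cmv_span K g -> z != 0 -> B (CDkernel X K z) g = (g z)^*.
Proof.
move=> hg z0; have lg := cmv_span_laurent hg.
rewrite (form_suml Bform _ (fun k : 'I_K => phi1_laurent X k))//.
rewrite (phi1_expansion (swap_form Bform) (swap_borel X)
  (swap_quasidefinite Bqd) hg z0) rmorph_sum; apply: eq_bigr => k _.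
rewrite !rmorphM fmorphV /= /swap /= !conjCK mulrC -mulrA [X in _ * X]mulrC.
by rewrite mulrA.
Qed.

End Form.

(** * Quasideterminants *)

Section Quasideterminant.
Variable C : numClosedFieldType.

Lemma det_Theta N (W : 'M[C]_N) (col : 'cV[C]_N) (r : 'rV[C]_N) (d : C) :
  \det W != 0 -> Theta W col r d = \det (block_mx W col r d%:M) / \det W.
Proof.
move=> W0; have Wu : W \in unitmx by rewrite unitmxE unitfE.
have -> : block_mx W col r d%:M =
    block_mx 1%:M 0 (r *m invmx W) 1%:M *m block_mx W col 0 (Theta W col r d)%:M.
  rewrite mulmx_block !mul1mx !mul0mx !addr0 mulmxKV//; congr block_mx.
  apply/matrixP => i j; rewrite !ord1 /Theta [LHS]mxE [RHS]mxE [X in _ + X]mxE.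
  by rewrite eqxx !mulr1n addrC subrK.
by rewrite det_mulmx det_lblock det_ublock !det1 !mul1r det_scalar1 mulrC mulKf.
Qed.

(** Both sides are, up to the factor [\det W], expansions along the row [r]
    with the same minors; their positions differ by [N - 1] rows, and for
    even [N] the resulting sign is the one of [Theta]. *)
Lemma Theta_first_col N (A : nat -> 'rV[C]_N) s (r : 'rV[C]_N) :
  ~~ odd N -> (0 < N)%N -> \det (window A s) != 0 ->
  Theta (window A s) (first_col _ N) r 0 =
    \det (window_last A s.+1 r) / \det (window A s).
Proof.
case: N A r => // N A r oN _ W0; rewrite /Theta sub0r.
have -> : \det (window_last A s.+1 r) =
    - \sum_j r ord0 j * cofactor (window A s) ord0 j.
  rewrite (expand_det_row _ ord_max) -sumrN; apply: eq_bigr => j _.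
  rewrite [window_last _ _ _ _ _]mxE eqxx -mulrN; congr (_ * _).
  rewrite /cofactor /= exprD add0n -signr_odd.
  have -> : odd N by move: oN; rewrite /= negbK.
  rewrite expr1 mulN1r mulNr; congr (- (_ * \det _)).
  apply/matrixP => a b; rewrite !mxE /= /bump leqNgt ltn_ord add0n /=.
  by rewrite eqSS ltn_eqF ?ltn_ord// addSn addnS.
rewrite mulNr; congr (- _).
have -> : invmx (window A s) = (\det (window A s))^-1 *: \adj (window A s).
  by rewrite /invmx unitmxE unitfE W0.
rewrite -scalemxAr -scalemxAl !mxE mulrC; congr (_ / _).
rewrite (bigD1 ord0)//= !mxE eqxx mulr1 [X in _ + X]big1 ?addr0.
  by apply: eq_bigr => j _; rewrite !mxE.
by move=> i; rewrite [first_col _ _ _ _]mxE -val_eqE => /negbTE ->; rewrite mulr0.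
Qed.

Lemma window_lastE N (A : nat -> 'rV[C]_N) s :
  window_last A s (A (s + N).-1) = window A s.
Proof.
apply/matrixP => i j; rewrite !mxE; case: eqP => // iN.
by congr (A _ _ _); rewrite -[in LHS]iN addnS.
Qed.

End Quasideterminant.

(** * Connection formulas for a form that [L] divides *)

Section Transformation.
Variable C : numClosedFieldType.
Variables B Bc : (C -> C) -> (C -> C) -> C.
Hypothesis Bform : sesquilinear_form B.
Hypothesis Bcform : sesquilinear_form Bc.
Hypothesis Bqd : quasidefinite (gram B).
Hypothesis Bcqd : quasidefinite (gram Bc).
Variable X : gauss_borel (gram B).
Variable Xc : gauss_borel (gram Bc).
Variable L : C -> C.
Hypothesis Llaurent : laurent L.
Hypothesis BcL : forall f g, laurent f -> laurent g ->
  Bc f (fun z => L z * g z) = B f g.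
Variables (N : nat) (lead : nat -> C).
Hypothesis Llead : forall k,
  cmv_span (k + N) (fun z => L z * chi k z - lead k * chi (k + N) z).

Lemma mulL_span k g : cmv_span k g -> cmv_span (k + N) (fun z => L z * g z).
Proof.
move=> [c cE].
apply: (@cmv_span_ext C _ (fun z => \sum_(j < k) c j * (L z * chi j z))).
  apply: cmv_span_sum => j _; apply: cmv_spanZ.
  have jk : (j + N < k + N)%N by rewrite ltn_add2r.
  apply: (cmv_span_ext (cmv_spanL (lead j) (cmv_span_chi C jk)
    (cmv_span_le (ltnW jk) (Llead j)))) => z z0.
  by rewrite addrC subrK.
move=> z z0; rewrite cE// mulr_sumr; apply: eq_bigr => j _.
by rewrite mulrCA.
Qed.

(** Multiplication by [L] raises the CMV index by [N] and multiplies the leading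
    coefficient by [lead]; as [phi2] and its transform are monic, the difference
    drops one index. *)
Lemma mulL_phi2 k : cmv_span (k + N)
  (fun z => L z * phi2 X k z - lead k * phi2 Xc (k + N) z).
Proof.
have h := cmv_spanL (- lead k) (phi2_monic Xc (k + N))
  (cmv_spanL 1 (mulL_span (phi2_monic X k)) (Llead k)).
apply: (cmv_span_ext h) => z z0.
by ring.
Qed.

Section Level.
Variable s : nat.
Hypothesis lead0 : lead s != 0.
Let l := (s + N)%N.

Let H0 := gH_neq0 Bform X Bqd.

(** The formulas come from two functions of the span of level [l]: [increment]
    gives the transforms of [phi1] and [H], [kernel_defect] that of [phi2].  By
    [BcL] the pairing under [B] with [phi2 X k] is a pairing under [Bc] with
    [L * phi2 X k], which lies below level [l] as long as [k < s]; both functions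
    are therefore combinations of [phi1 X s], ..., [phi1 X (l - 1)]. *)
Definition increment (z : C) : C := phi1 Xc l z - phi1 X l z.

Definition kernel_defect (z x : C) : C :=
  CDkernel Xc l z x - (L z)^* * CDkernel X l z x.

Lemma increment_span : cmv_span l increment.
Proof.
apply: (cmv_span_ext (cmv_spanB (phi1_monic Xc l) (phi1_monic X l))) => z _.
by rewrite opprB addrA subrK.
Qed.

Lemma increment_pairing k : (k < l)%N ->
  B increment (phi2 X k) = Bc (phi1 Xc l) (fun z => L z * phi2 X k z).
Proof.
move=> kl; rewrite BcL//; [|exact: phi1_laurent|exact: phi2_laurent].
rewrite (form_subl Bform);
  [|exact: phi1_laurent|exact: phi1_laurent|exact: phi2_laurent].
by rewrite biorthogonality// gtn_eqF// mul0r subr0.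
Qed.

Lemma increment_orth k : (k < s)%N -> B increment (phi2 X k) = 0.
Proof.
move=> ks; rewrite increment_pairing; last by rewrite ltn_addr.
apply: (phi1_orth Bcform); apply: cmv_span_le (mulL_span (phi2_span X k)).
by rewrite leq_add2r.
Qed.

(** Among [L * phi2 X k] for [k <= s], only [k = s] reaches level [l]. *)
Lemma increment_head : (0 < N)%N ->
  B increment (phi2 X s) = (lead s)^* * gH Xc l.
Proof.
move=> N0; rewrite increment_pairing; last by rewrite -ltn_subLR ?subnn.
have l1 := phi1_laurent Xc l; have l2 := phi2_laurent Xc l.
have ld := cmv_span_laurent (mulL_phi2 s).
rewrite -(phi_norm Bcform Xc) -[RHS]addr0 -(phi1_orth Bcform Xc (mulL_phi2 s)).
rewrite -(form_antilinear Bcform)//; apply: (form_ext Bcform) => //.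
- by apply: laurentM => //; exact: phi2_laurent.
- exact: laurentL.
- by move=> z _; rewrite addrC subrK.
Qed.

Lemma defect_span z : cmv_span l (kernel_defect z).
Proof.
exact: cmv_spanB (kernel_span Xc l z) (cmv_spanZ _ (kernel_span X l z)).
Qed.

Lemma defect_pairing k z : (k < l)%N -> z != 0 -> B (kernel_defect z) (phi2 X k) =
  Bc (CDkernel Xc l z) (fun x => L x * phi2 X k x) - (L z * phi2 X k z)^*.
Proof.
move=> kl z0; have l2 := phi2_laurent X k.
have lk := cmv_span_laurent (kernel_span X l z).
have lkc := cmv_span_laurent (kernel_span Xc l z).
rewrite BcL// rmorphM /= -(kernel_reproducing Bform X Bqd (cmv_span_le kl (phi2_span X k)) z0).
rewrite -mulNr addrC -(form_linear Bform)//; apply: (form_ext Bform) => //.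
- exact: cmv_span_laurent (defect_span z).
- exact: laurentL.
- by move=> x _; rewrite mulNr addrC.
Qed.

Lemma defect_orth k z : (k < s)%N -> z != 0 -> B (kernel_defect z) (phi2 X k) = 0.
Proof.
move=> ks z0; rewrite defect_pairing//; last by rewrite ltn_addr.
rewrite (kernel_reproducing Bcform Xc Bcqd) ?subrr//.
apply: cmv_span_le (mulL_span (phi2_span X k)).
by rewrite leq_add2r.
Qed.

Lemma defect_head z : (0 < N)%N -> z != 0 ->
  B (kernel_defect z) (phi2 X s) = - ((lead s)^* * (phi2 Xc l z)^*).
Proof.
move=> N0 z0; rewrite defect_pairing//; last by rewrite -ltn_subLR ?subnn.
have lkc := cmv_span_laurent (kernel_span Xc l z).
have ls := mulL_phi2 s; have l2 := phi2_laurent Xc l.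
have := kernel_reproducing Bcform Xc Bcqd ls z0.
have E : Bc (CDkernel Xc l z) (fun x => L x * phi2 X s x) =
    (lead s)^* * Bc (CDkernel Xc l z) (phi2 Xc l) + Bc (CDkernel Xc l z)
      (fun x => L x * phi2 X s x - lead s * phi2 Xc l x).
  have ld := cmv_span_laurent ls.
  rewrite -(form_antilinear Bcform)//; apply: (form_ext Bcform) => //.
  - by apply: laurentM => //; exact: phi2_laurent.
  - exact: laurentL.
  - by move=> x _; rewrite addrC subrK.
rewrite E (phi2_orth Bcform Xc (kernel_span Xc l z)) mulr0 add0r => ->.
by rewrite rmorphB !rmorphM /= addrC addKr.
Qed.

(* In the application the [q j] are the partial quotients of [L]: testing a
   combination of the [phi1] against them yields linear equations for its
   coefficients, whose matrix is the window. *)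
Variable q : 'I_N -> C -> C.
Hypothesis q_span : forall j, cmv_span N (q j).
Variable A : nat -> 'rV[C]_N.
Hypothesis AE : forall k j, A k ord0 j = - Bc (phi1 X k) (q j).
Variable Rl : C -> 'rV[C]_N.
Hypothesis RlE : forall z j, z != 0 ->
  Rl z ord0 j = (q j z)^* - (L z)^* * Bc (CDkernel X l z) (q j).
Hypothesis tau0 : \det (window A s) != 0.

Lemma row_of_tail (f : C -> C) (w : 'I_N -> C) (r : 'rV[C]_N) : laurent f ->
  (forall z, z != 0 -> f z = \sum_i w i * phi1 X (s + i) z) ->
  (forall j, r ord0 j = Bc f (q j)) ->
  r *m invmx (window A s) = - \row_i w i.
Proof.
move=> lf fE rE; have Wu : window A s \in unitmx by rewrite unitmxE unitfE.
suff -> : r = - (\row_i w i) *m window A s by rewrite mulmxK.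
apply/rowP => j; rewrite rE !mxE.
have lq := cmv_span_laurent (q_span j).
have lp (i : 'I_N) : laurent (phi1 X (s + i)) := phi1_laurent X (s + i).
rewrite (form_ext Bcform lf _ lq lq fE)//; last first.
  by apply: laurent_sum => i; exact: laurentZ.
rewrite (form_suml Bcform)//; apply: eq_bigr => i _.
by rewrite !mxE AE mulrN mulNr opprK.
Qed.

(** The transform of [phi1] of index [l] is orthogonal to the [q j], because these
    lie below level [N <= l]. *)
Lemma row_increment : A l *m invmx (window A s) =
  - \row_i (B increment (phi2 X (s + i)) / gH X (s + i)).
Proof.
apply: row_of_tail (cmv_span_laurent increment_span) _ _.
  exact: (phi1_tail Bform Bqd increment_span increment_orth).
move=> j; have lq := cmv_span_laurent (q_span j).
rewrite AE (form_subl Bcform)//; try exact: phi1_laurent.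
rewrite (phi1_orth Bcform) ?sub0r//.
by apply: cmv_span_le (q_span j); rewrite leq_addl.
Qed.

(** The kernel of the transform reproduces [q j], so that the row [Rl] consists of
    the pairings of [kernel_defect] with the [q j]. *)
Lemma row_defect z : z != 0 -> Rl z *m invmx (window A s) =
  - \row_i (B (kernel_defect z) (phi2 X (s + i)) / gH X (s + i)).
Proof.
move=> z0; apply: row_of_tail (cmv_span_laurent (defect_span z)) _ _.
  apply: (phi1_tail Bform Bqd (defect_span z)) => k ks.
  exact: defect_orth.
move=> j; have lq := cmv_span_laurent (q_span j).
have lk := cmv_span_laurent (kernel_span X l z).
have lkc := cmv_span_laurent (kernel_span Xc l z).
rewrite RlE// -(kernel_reproducing Bcform Xc Bcqd (K := l))//; last first.
  by apply: cmv_span_le (q_span j); rewrite leq_addl.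
rewrite -mulNr addrC -(form_linear Bcform)//; apply: (form_ext Bcform) => //.
- exact: laurentL.
- exact: cmv_span_laurent (defect_span z).
- by move=> x _; rewrite mulNr addrC.
Qed.

Lemma mul_first_col (w : 'rV[C]_N) (i : 'I_N) :
  val i = 0%N -> (w *m first_col C N) ord0 ord0 = w ord0 i.
Proof.
move=> i0; rewrite mxE (bigD1 i)//= !mxE i0 eqxx mulr1 big1 ?addr0// => j.
rewrite mxE -val_eqE i0 => /negbTE ->; by rewrite mulr0.
Qed.

Theorem phi1_transformed z : z != 0 -> phi1 Xc l z =
  Theta (window A s) (\col_i phi1 X (s + i) z) (A l) (phi1 X l z).
Proof.
move=> z0; rewrite /Theta row_increment mulNmx !mxE opprK.
apply/eqP; rewrite addrC -subr_eq; apply/eqP.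
rewrite -[LHS]/(increment z).
rewrite (phi1_tail Bform Bqd increment_span increment_orth z0).
by apply: eq_bigr => i _; rewrite !mxE.
Qed.

Hypothesis N0 : (0 < N)%N.

Theorem norm_transformed : gH Xc l =
  gH X s / (lead s)^* * Theta (window A s) (first_col C N) (A l) 0.
Proof.
rewrite /Theta sub0r row_increment mulNmx [X in - X]mxE opprK.
rewrite (@mul_first_col _ (Ordinal N0))// mxE addn0 increment_head//.
have := H0 s; have : (lead s)^* != 0 by rewrite conjC_eq0.
by move=> h1 h2; field; rewrite h1 h2.
Qed.

Theorem phi2_transformed z : z != 0 -> (phi2 Xc l z)^* =
  - (gH X s / (lead s)^*) * Theta (window A s) (first_col C N) (Rl z) 0.
Proof.
move=> z0; rewrite /Theta sub0r row_defect// mulNmx [X in _ * - X]mxE opprK.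
rewrite (@mul_first_col _ (Ordinal N0))// mxE addn0 defect_head//.
have := H0 s; have : (lead s)^* != 0 by rewrite conjC_eq0.
by move=> h1 h2; field; rewrite h1 h2.
Qed.

End Level.
End Transformation.

(** * Taylor coefficients of Laurent polynomials *)

Section Derivatives.
Variable C : numClosedFieldType.
Implicit Types (f g : C -> C) (z a : C).

Lemma near_neq0 z : z != 0 -> \forall w \near z, w != 0.
Proof.
have h : (fun w : C => w) w @[w --> z] --> z by exact: cvg_id.
exact: (@cvgr_neq0 C C C (nbhs z) _ id z h).
Qed.

Lemma is_derive1 f z d :
  is_derive z 1 f d <-> h^-1 *: (f (h + z) - f z) @[h --> 0^'] --> d.
Proof.
have E : (fun h : C => h^-1 *: ((f \o shift z) (h *: 1) - f z)) =
    (fun h : C => h^-1 *: (f (h + z) - f z)).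
  by apply/funext => h /=; rewrite [h *: 1]mulr1.
split=> [[df <-]|dfl]; first by rewrite -E; exact: df.
by rewrite -E in dfl; split; [apply/cvg_ex; exists d|exact: cvg_lim dfl].
Qed.

Lemma is_derive1_val f z d : is_derive z 1 f d -> derive1 f z = d.
Proof. by move=> [_ <-]; rewrite derive1E. Qed.

Lemma is_derive_continuous f z d : is_derive z 1 f d -> {for z, continuous f}.
Proof.
by move=> [/derivable1_diffP h _]; apply: differentiable_continuous.
Qed.

Lemma is_derive_horner (p : {poly C}) z : is_derive z 1 (horner p) (p^`()).[z].
Proof.
elim/poly_ind: p => [|p c IHp].
  rewrite deriv0 horner0; apply: near_eq_is_derive (is_derive_cst 0 z 1).
  by near=> w; rewrite /= horner0.
have h := is_deriveD (is_deriveM IHp (is_derive_id z 1)) (is_derive_cst c z 1).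
apply: (near_eq_is_derive (f := (fun w => p.[w] * w) + cst c)).
  by near=> w; rewrite !hornerE.
apply: is_derive_eq; rewrite derivD derivC derivM derivX !hornerE.
by rewrite addrC [z *: _]mulrC [_ *: 1]mulr1.
Unshelve. all: by end_near. Qed.

(** Laurent polynomials are closed under differentiation, so that all their
    derivatives exist away from [0]. *)
Lemma laurent_derive f : laurent f ->
  exists2 f', laurent f' & forall z, z != 0 -> is_derive z 1 f (f' z).
Proof.
move=> [p [N fE]].
exists (fun z => (p^`() * 'X^N - p * ('X^N)^`()).[z] / z ^+ (N * 2)).
  by exists (p^`() * 'X^N - p * ('X^N)^`()), (N * 2)%N.
move=> z z0; have zN : z ^+ N != 0 by rewrite expf_neq0.
apply: (near_eq_is_derive (f := fun w => p.[w] * (('X^N).[w])^-1)).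
  near=> w; rewrite fE ?hornerXn//; near: w; exact: near_neq0.
have XN0 : ('X^N : {poly C}).[z] != 0 by rewrite hornerXn.
have h := is_derive_horner 'X^N z.
have hV : is_derive z 1 (fun w => (('X^N : {poly C}).[w])^-1)
    (- ('X^N).[z] ^- 2 *: ('X^N)^`().[z]).
  have [dX <-] := h.
  by apply: DeriveDef; [exact: derivableV|exact: deriveV].
apply: is_derive_eq (is_deriveM (is_derive_horner p z) hV) _.
rewrite !hornerE /GRing.scale /= exprM.
by field.
Unshelve. all: by end_near. Qed.

Lemma laurent_is_derive f z : laurent f -> z != 0 -> is_derive z 1 f (derive1 f z).
Proof.
by move=> /laurent_derive[f' _ fE] z0; rewrite (is_derive1_val (fE z z0)); exact: fE.
Qed.

Lemma laurent_derive1 f : laurent f -> laurent (derive1 f).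
Proof.
move=> /laurent_derive[f' lf' fE]; apply: laurent_ext lf' _ => z z0.
exact: is_derive1_val (fE z z0).
Qed.

Lemma laurent_derive1n k f : laurent f -> laurent (derive1n k f).
Proof. by elim: k f => // k IHk f lf; apply/laurent_derive1/IHk. Qed.

(** Higher derivatives only depend on the germ.  This is used for functions that
    have a known closed form, or a meaning, only off the support. *)
Lemma derive1n_near k f g z :
  (\forall w \near z, f w = g w) -> derive1n k f z = derive1n k g z.
Proof.
elim: k z => [z /nbhs_singleton//|k IHk z fg] /=.
rewrite !derive1E; apply: near_eq_derive.
by apply: filterS (nbhs_interior fg) => w; exact: IHk.
Qed.

Lemma derive1n_ext k f g z : (forall w, w != 0 -> f w = g w) -> z != 0 ->
  derive1n k f z = derive1n k g z.
Proof.
move=> fg z0; apply: derive1n_near; near=> w; apply: fg; near: w.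
exact: near_neq0.
Unshelve. all: by end_near. Qed.

Lemma derive1nL k (c : C) f g z : laurent f -> laurent g -> z != 0 ->
  derive1n k (fun w => c * f w + g w) z = c * derive1n k f z + derive1n k g z.
Proof.
move=> lf lg; elim: k z => // k IHk z z0 /=.
have lfk := laurent_is_derive (laurent_derive1n k lf) z0.
have lgk := laurent_is_derive (laurent_derive1n k lg) z0.
apply: is_derive1_val; apply: near_eq_is_derive (is_deriveD (is_deriveZ c lfk) lgk).
by near=> w; apply/esym/IHk; near: w; exact: near_neq0.
Unshelve. all: by end_near. Qed.

Lemma derive1n_cst k (c : C) z : derive1n k.+1 (fun=> c) z = 0.
Proof.
suff E i : derive1n i (fun=> 0 : C) = (fun=> 0).
  rewrite /derive1n iterSr.
  have -> : derive1 (fun=> c) = (fun=> 0 : C) by apply/funext => w; exact: derive1_cst.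
  by rewrite -/(derive1n k _) E.
elim: i => //= i ->; apply/funext => w; exact: derive1_cst.
Qed.

Definition taylor k f z : C := derive1n k f z / k`!%:R.

Lemma taylor_ext k f g z : (forall w, w != 0 -> f w = g w) -> z != 0 ->
  taylor k f z = taylor k g z.
Proof. by move=> fg z0; rewrite /taylor (derive1n_ext k fg z0). Qed.

Lemma taylorL k (c : C) f g z : laurent f -> laurent g -> z != 0 ->
  taylor k (fun w => c * f w + g w) z = c * taylor k f z + taylor k g z.
Proof. by move=> lf lg z0; rewrite /taylor derive1nL// mulrDl mulrA. Qed.

Lemma laurent_subr a : laurent (fun z => z - a).
Proof. by apply: laurent_ext (laurent_poly ('X - a%:P)) _ => z _; rewrite !hornerE. Qed.

(** Leibniz rule for a linear factor, which is all that is needed to divide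
    zeros out. *)
Lemma derive1n_mul_subr k a g z : laurent g -> z != 0 ->
  derive1n k (fun w => (w - a) * g w) z =
    (z - a) * derive1n k g z + k%:R * derive1n k.-1 g z.
Proof.
move=> lg; elim: k z => [z z0|k IHk z z0]; first by rewrite mul0r addr0.
rewrite [LHS]/=; apply: is_derive1_val.
have dk := laurent_is_derive (laurent_derive1n k lg) z0.
have ds : is_derive z 1 (fun w : C => w - a) 1.
  apply: is_derive_eq (is_deriveB (is_derive_id z 1) (is_derive_cst a z 1)) _.
  by rewrite subr0.
apply: (near_eq_is_derive (f := fun w =>
    (w - a) * derive1n k g w + k%:R * derive1n k.-1 g w)).
  by near=> w; apply/esym/IHk; near: w; exact: near_neq0.
have dk1 := laurent_is_derive (laurent_derive1n k.-1 lg) z0.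
apply: is_derive_eq (is_deriveD (is_deriveM ds dk) (is_deriveZ k%:R dk1)) _.
rewrite /GRing.scale /= mulr1 -addrA; congr (_ + _).
case: k {IHk dk dk1} => [|k]; first by rewrite mul0r addr0 mul1r.
by rewrite -[k.+2]add1n natrD mulrDl mul1r.
Unshelve. all: by end_near. Qed.

Lemma taylor_mul_subr k a g : laurent g -> a != 0 ->
  taylor k (fun w => (w - a) * g w) a = if k is j.+1 then taylor j g a else 0.
Proof.
move=> lg a0; rewrite /taylor derive1n_mul_subr// subrr mul0r add0r.
case: k => [|k]; first by rewrite !mul0r.
rewrite factS natrM /=; have k0 : k.+1%:R != 0 :> C by rewrite pnatr_eq0.
by rewrite -mulf_div divff// mul1r.
Qed.

Lemma laurent_subrX a m : laurent (fun z => (z - a) ^+ m).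
Proof.
by apply: laurent_ext (laurent_poly (('X - a%:P) ^+ m)) _ => z _; rewrite !hornerE.
Qed.

Lemma taylor_mul_subrX k m a g : laurent g -> a != 0 ->
  taylor k (fun w => g w * (w - a) ^+ m) a =
    if (m <= k)%N then taylor (k - m) g a else 0.
Proof.
move=> lg a0; elim: m k => [|m IHm] k.
  by rewrite subn0; apply: taylor_ext => // z _; rewrite mulr1.
have lm : laurent (fun w => g w * (w - a) ^+ m).
  by apply: laurentM => //; exact: laurent_subrX.
rewrite -(@taylor_ext k (fun w => (w - a) * (g w * (w - a) ^+ m))) => [|z _|//].
  by rewrite taylor_mul_subr//; case: k => // k; rewrite IHm.
by rewrite exprS mulrCA.
Qed.

Lemma cvg_conj0 : (h : C)^* @[h --> (0:C)^'] --> (0:C)^'.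
Proof.
move=> A [r r0 rA]; exists r => // y /=; rewrite sub0r normrN => yr y0.
by apply: rA; rewrite /= ?sub0r ?normrN ?norm_conjC// conjC_eq0.
Qed.

Lemma continuous_conj : continuous (@Num.conj C).
Proof.
move=> z A [e e0 eA]; exists e => // w zw.
by apply: eA; rewrite /= -rmorphB norm_conjC.
Qed.

Lemma near_conj z (P : C -> Prop) :
  (\forall w \near z^*, P w) -> \forall w \near z, P w^*.
Proof. by move=> h; apply: continuous_conj h. Qed.

Lemma is_derive_bar f z d : is_derive z^* 1 f d -> is_derive z 1 (bar f) d^*.
Proof.
move=> /is_derive1 fd; apply/is_derive1.
have := cvg_comp _ _ (cvg_comp _ _ cvg_conj0 fd) (continuous_conj (x := d)).
apply: cvg_trans; apply: near_eq_cvg; apply: nearW => h /=.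
by rewrite /bar /GRing.scale /= rmorphM rmorphB fmorphV /= conjCK rmorphD.
Qed.

Lemma derive1n_bar k f z : laurent f -> z != 0 ->
  derive1n k (bar f) z = (derive1n k f z^*)^*.
Proof.
move=> lf; elim: k z => // k IHk z z0 /=; apply: is_derive1_val.
have cz0 : z^* != 0 by rewrite conjC_eq0.
have h := is_derive_bar (laurent_is_derive (laurent_derive1n k lf) cz0).
apply: near_eq_is_derive h.
by near=> w; apply/esym/IHk; near: w; exact: near_neq0.
Unshelve. all: by end_near. Qed.

End Derivatives.

(** * Prepared Laurent polynomials *)

Section Prepared.
Variables (C : numClosedFieldType) (n : nat) (L : prepared C n).
Local Notation P := (laurent_num n (lcoef L)).

Lemma laurent_num_factor :
  P = (lcoef L n%:Z)%:P * \prod_(i < nzeros L) ('X - (zeta L i)%:P) ^+ mult L i.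
Proof.
have [cn0 cN0] : lcoef L n%:Z != 0 /\ lcoef L (- n%:Z) != 0.
  by apply/andP; rewrite -negb_or -mulf_eq0 lcoef_neq0.
have sp : size P = (2 * n).+1.
  by apply: size_poly_eq; rewrite /= mul2n -addnn PoszD addrK.
have lp : lead_coef P = lcoef L n%:Z.
  rewrite lead_coefE sp /= coef_poly ltnS leqnn; congr (lcoef L _); lia.
have p00 : P`_0 != 0 by rewrite coef_poly /= sub0r.
have [r rP] := closed_field_poly_normal P.
have cnt i : mult L i = count_mem (zeta L i) r.
  rewrite -zeta_mult {1}rP -mul_polyC mupMr ?mu_prod_XsubC//.
  by rewrite rootC lp.
rewrite {1}rP lp -mul_polyC; congr (_ * _).
transitivity (\prod_(i < nzeros L) \prod_(x <- r)
    (if x == zeta L i then 'X - x%:P else 1)).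
  rewrite exchange_big /= !big_seq; apply: eq_bigr => x xr.
  have rx : root P x by rewrite rP rootZ ?lp// root_prod_XsubC.
  have x0 : x != 0.
    by apply: contraNneq p00 => x0; rewrite -horner_coef0 -[X in _.[X]]x0; exact: rx.
  have [i xi] := zeta_all x0 rx.
  rewrite (bigD1 i)//= xi eqxx big1 ?mulr1// => j ji.
  by rewrite (inj_eq (@zeta_inj _ _ L)) eq_sym (negbTE ji).
apply: eq_bigr => i _; rewrite cnt -big_mkcond /=.
rewrite (eq_bigr (fun=> 'X - (zeta L i)%:P)) => [|x /eqP-> //].
by rewrite big_const_seq iter_mulr_1.
Qed.

Lemma lremoveE j z : z != 0 -> lremove (L := L) j z =
  ((lcoef L n%:Z)%:P *
   \prod_(i < nzeros L | i != j) ('X - (zeta L i)%:P) ^+ mult L i).[z] / z ^+ n.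
Proof.
move=> z0; rewrite /lremove hornerM hornerC horner_prod mulrAC; congr (_ * _ / _).
by apply: eq_bigr => i _; rewrite !hornerE.
Qed.

Lemma leval_lremove j z : z != 0 ->
  leval L z = lremove (L := L) j z * (z - zeta L j) ^+ mult L j.
Proof.
move=> z0; rewrite levalE// laurent_num_factor lremoveE// (bigD1 j)//= !hornerM.
rewrite !hornerE /=; field.
by rewrite expf_neq0.
Qed.

Lemma leval_laurent : laurent (leval L).
Proof. by exists P, n => z z0; rewrite levalE. Qed.

Lemma lremove_laurent j : laurent (lremove (L := L) j).
Proof. by eexists _, n => z z0; exact: lremoveE. Qed.

Lemma leval_zeta j : leval L (zeta L j) = 0.
Proof.
by rewrite (leval_lremove j (zeta_neq0 _)) subrr expr0n gtn_eqF ?mult_gt0// mulr0.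
Qed.

(** This is [L(z) / (z - zeta_j)^(r+1)] with the singularity removed.  These
    [2 n] Laurent polynomials are the test functions that turn orthogonality
    for the transformed functional into the rows of jets. *)
Definition partial_quotient (j : 'I_(nzeros L)) (r : nat) (z : C) : C :=
  lremove j z * (z - zeta L j) ^+ (mult L j - r.+1).
Local Notation q := partial_quotient.

Lemma partial_quotientE j r z : z != 0 -> (r < mult L j)%N ->
  leval L z = q j r z * (z - zeta L j) ^+ r.+1.
Proof.
by move=> z0 rm; rewrite (leval_lremove j)// /q -mulrA -exprD subnK.
Qed.

(** The powers from [-n] to [n - 1] are exactly those of CMV index below
    [2 n]. *)
Lemma laurent_cmv_span (Q : {poly C}) : (size Q <= 2 * n)%N ->
  cmv_span (2 * n) (fun z => Q.[z] / z ^+ n).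
Proof.
move=> sQ; apply: (@cmv_span_ext _ _
    (fun z => \sum_(i < 2 * n) Q`_i * z ^ (i%:Z - n%:Z))).
  apply: cmv_span_sum => i _; apply/cmv_spanZ/cmv_span_exp;
    have := ltn_ord i; lia.
move=> z z0; rewrite (horner_coef_wide _ sQ) mulr_suml; apply: eq_bigr => i _.
by rewrite expfzDr// -mulrA exprnN.
Qed.

Lemma partial_quotient_span j r : (r < mult L j)%N -> cmv_span (2 * n) (q j r).
Proof.
move=> rm; pose Q := (lcoef L n%:Z)%:P *
  \prod_(i < nzeros L | i != j) ('X - (zeta L i)%:P) ^+ mult L i *
  ('X - (zeta L j)%:P) ^+ (mult L j - r.+1).
apply: (@cmv_span_ext _ _ (fun z => Q.[z] / z ^+ n)); last first.
  by move=> z z0; rewrite /q lremoveE// /Q [in RHS]hornerM mulrAC !hornerE.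
apply: laurent_cmv_span.
have cn0 : lcoef L n%:Z != 0.
  by have := lcoef_neq0 L; rewrite mulf_eq0 negb_or => /andP[].
have nz k i : ('X - (zeta L i)%:P) ^+ k != 0.
  by rewrite expf_neq0// polyXsubC_eq0.
have P0 : P != 0.
  rewrite laurent_num_factor mulf_neq0 ?polyC_eq0//.
  by apply/prodf_neq0 => i _; exact: nz.
have QP : Q * ('X - (zeta L j)%:P) ^+ r.+1 = P.
  rewrite laurent_num_factor (bigD1 j)//= /Q -!mulrA -exprD subnK//.
  by congr (_ * _); rewrite mulrC.
have Q0 : Q != 0 by apply: contraNneq P0 => Q0; rewrite -QP Q0 mul0r.
have : (size P <= (2 * n).+1)%N by exact: size_poly.
rewrite -QP size_Mmonic ?monic_exp ?monicXsubC// size_exp_XsubC addnS /= addnS.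
lia.
Qed.

Lemma taylor_partial_quotient j r s : taylor s (q j r) (zeta L j) =
  if (mult L j - r.+1 <= s)%N
  then taylor (s - (mult L j - r.+1)) (lremove (L := L) j) (zeta L j) else 0.
Proof. exact: taylor_mul_subrX (lremove_laurent j) (zeta_neq0 _). Qed.

Lemma taylor_partial_quotient_other i j r s : i != j -> (s < mult L i)%N ->
  taylor s (q j r) (zeta L i) = 0.
Proof.
move=> ij sm; pose h z := (lcoef L n%:Z * z ^- n *
  \prod_(k < nzeros L | (k != j) && (k != i)) (z - zeta L k) ^+ mult L k) *
  (z - zeta L j) ^+ (mult L j - r.+1).
have hl : laurent h.
  apply: laurentM; last exact: laurent_subrX.
  apply: (@laurent_ext _ (fun z => lcoef L n%:Z * z ^ (- n%:Z) *
    (\prod_(k < nzeros L | (k != j) && (k != i))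
       ('X - (zeta L k)%:P) ^+ mult L k).[z])).
    apply: laurentM; last exact: laurent_poly.
    by apply: laurentZ; exact: laurent_exp.
  move=> z z0; rewrite exprnN horner_prod; congr (_ * _).
  by apply: eq_bigr => k _; rewrite !hornerE.
rewrite (@taylor_ext _ _ _ (fun z => h z * (z - zeta L i) ^+ mult L i)).
- by rewrite (taylor_mul_subrX _ _ hl) ?zeta_neq0// leqNgt sm.
- move=> z z0; rewrite /q /lremove /h (bigD1 i)//=.
  by rewrite [_ ^+ mult L i * _]mulrC mulrA mulrAC.
- exact: zeta_neq0.
Qed.

(** [L * chi k] is a combination of [2 n + 1] consecutive powers; the one of
    largest CMV index is the highest power for even [k] and the lowest one for
    odd [k], whence the sign in the index of the coefficient. *)
Lemma leval_chi k : cmv_span (k + 2 * n)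
  (fun z => leval L z * chi k z - lcoef L ((-1) ^+ k * n%:Z) * chi (k + 2 * n) z).
Proof.
pose t (e : int) (j : nat) z : C := lcoef L (j%:Z - n%:Z) * z ^ (j%:Z - n%:Z + e).
have LE e z : z != 0 -> chi k z = z ^ e ->
    leval L z * chi k z = \sum_(j < (2 * n).+1) t e j z.
  move=> z0 ->; rewrite mulr_suml; apply: eq_bigr => j _.
  by rewrite -mulrA -expfzDr.
have oddk : odd (k + 2 * n) = odd k by rewrite oddD oddM addbF.
case: (boolP (odd k)) => ok.
  apply: (@cmv_span_ext _ _
      (fun z => \sum_(j < 2 * n) t (- ((k.+1)./2)%:Z) j.+1 z)).
    apply: cmv_span_sum => j _; apply/cmv_spanZ/cmv_span_exp;
      have := ltn_ord j; lia.
  move=> z z0; rewrite (LE (- ((k.+1)./2)%:Z)) ?chiE ?ok// oddk ok.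
  rewrite big_ord_recl /= /t addrAC -signr_odd ok expr1 mulN1r sub0r.
  have -> : - n%:Z + - (k.+1)./2%:Z = - ((k + 2 * n).+1)./2%:Z by lia.
  by rewrite subrr add0r.
apply: (@cmv_span_ext _ _ (fun z => \sum_(j < 2 * n) t ((k./2)%:Z) j z)).
  apply: cmv_span_sum => j _; apply/cmv_spanZ/cmv_span_exp;
    have := ltn_ord j; lia.
move=> z z0; rewrite (LE (k./2)%:Z) ?chiE ?(negbTE ok)// oddk (negbTE ok).
rewrite big_ord_recr /= /t -signr_odd (negbTE ok) expr0 mul1r.
have -> : (2 * n)%:Z - n%:Z = n%:Z by lia.
have -> : n%:Z + (k./2)%:Z = ((k + 2 * n)./2)%:Z by lia.
by rewrite addrK.
Qed.

(** The numerator of [L(x) - L(z)] as a function of [x] vanishes at [z]; the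
    value chosen on the diagonal is that of the quotient. *)
Lemma deltaL_laurent z : z != 0 -> laurent (fun x => deltaL L x z) /\
  forall x, x != 0 -> (x - z) * deltaL L x z = leval L x - leval L z.
Proof.
move=> z0; pose Q := P - leval L z *: 'X^n.
have : root Q z.
  by rewrite /root !hornerE levalE// divfK ?expf_neq0// subrr.
move=> /factor_theorem[S QE].
pose D x := S.[x] / x ^+ n.
have lD : laurent D by exists S, n.
have DE x : x != 0 -> (x - z) * D x = leval L x - leval L z.
  move=> x0; rewrite /D mulrA.
  have -> : (x - z) * S.[x] = Q.[x] by rewrite QE hornerM hornerXsubC mulrC.
  rewrite levalE// !hornerE; field.
  by rewrite expf_neq0.
have deltaE x : x != 0 -> deltaL L x z = D x.
  move=> x0; rewrite /deltaL; case: eqVneq => [->|xz].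
    have <- : taylor 1 (fun w => (w - z) * D w) z = D z.
      by rewrite taylor_mul_subr// /taylor fact0 divr1.
    rewrite /taylor divr1.
    transitivity (derive1n 1 (fun w => 1 * leval L w + (fun=> - leval L z) w) z).
      rewrite derive1nL ?mul1r//=; last first.
      - by apply: laurent_ext (laurent_poly (- leval L z)%:P) _ => w _; rewrite hornerC.
      - exact: leval_laurent.
      by rewrite derive1_cst addr0.
    by apply: derive1n_ext => // w w0; rewrite mul1r DE.
  by rewrite -DE// mulrAC mulfV ?mul1r// subr_eq0.
split; first exact: laurent_ext lD deltaE.
by move=> x x0; rewrite deltaE// DE.
Qed.

(** Comparing Taylor coefficients at [zeta_j] in
    [(x - z) * deltaL(x, z) = L(x) - L(z)] gives a recursion in the order, which
    determines them when [z != zeta_j]; for [z = zeta_j] they are those of [L],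
    shifted by one. *)
Lemma taylor_deltaL j r z : z != 0 -> (r < mult L j)%N ->
  taylor r (fun x => deltaL L x z) (zeta L j) = q j r z.
Proof.
move=> z0; have [lD DE] := deltaL_laurent z0.
set a := zeta L j; have a0 : a != 0 := zeta_neq0 j.
set D := fun x => deltaL L x z.
have lc : laurent (fun=> - leval L z).
  by apply: laurent_ext (laurent_poly (- leval L z)%:P) _ => w _; rewrite hornerC.
have lL := leval_laurent.
have tL k : (k < mult L j)%N -> taylor k (leval L) a = 0.
  move=> km; rewrite (taylor_ext k (leval_lremove j))//.
  by rewrite (taylor_mul_subrX _ _ (lremove_laurent j))// leqNgt km.
have tc k : taylor k (fun=> - leval L z) a = if k is 0 then - leval L z else 0.
  rewrite /taylor; case: k => [|k]; first by rewrite fact0 divr1.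
  by rewrite derive1n_cst mul0r.
set t := fun k => taylor k D a; rewrite -/(t r).
have rec k : (a - z) * t k + (if k is i.+1 then t i else 0) =
    taylor k (leval L) a + (if k is 0 then - leval L z else 0).
  have E1 := taylorL k (a - z) lD (laurentM (laurent_subr a) lD) a0.
  have E2 := taylorL k 1 lL lc a0.
  rewrite (taylor_mul_subr k lD a0) in E1.
  rewrite mul1r tc in E2; rewrite -E1 -E2; apply: taylor_ext => // x x0.
  by rewrite mul1r -DE// -mulrDl addrC addrA subrK.
have tr k : (k < mult L j)%N -> t k * (z - a) ^+ k.+1 = leval L z.
  elim: k => [|k IHk] km.
    have := rec 0%N; rewrite tL// addr0 add0r => /eqP; rewrite -opprB mulNr eqr_opp => /eqP.
    by rewrite mulrC expr1.
  have := rec k.+1; rewrite tL// addr0 => /eqP; rewrite -opprB mulNr addrC subr_eq0 => /eqP tk.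
  by rewrite -IHk ?tk 1?ltnW// exprS mulrCA mulrA.
move=> rm; have [za|za] := eqVneq z a; last first.
  have zar : (z - a) ^+ r.+1 != 0 by rewrite expf_neq0// subr_eq0.
  by apply: (mulIf zar); rewrite tr// (partial_quotientE z0 rm).
have := rec r.+1; rewrite za subrr mul0r add0r addr0 => ->.
rewrite (taylor_ext _ (leval_lremove j))//.
rewrite (taylor_mul_subrX _ _ (lremove_laurent j))// /q -/a subrr expr0n subn_eq0.
rewrite leq_eqVlt ltnNge rm orbF; case: eqP => [->|_]; last by rewrite mulr0.
by rewrite subnn /taylor fact0 divr1 mulr1.
Qed.

End Prepared.

(** * Forms that admit Cauchy kernels *)

Section CauchyForm.
Variable C : numClosedFieldType.
Implicit Types (S : set C) (B : (C -> C) -> (C -> C) -> C) (f g : C -> C).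

(** What the two variables of a bivariate functional have in common: the second
    slot admits the functions regular on [S], and in particular Cauchy kernels
    with pole off [S], which can be differentiated under the pairing. *)
Record cauchy_form S B : Prop := CauchyForm {
  cauchy_linear : forall (a : C) f f' g,
    laurent f -> laurent f' -> rational_off S g ->
    B (fun z => a * f z + f' z) g = a * B f g + B f' g;
  cauchy_antilinear : forall (a : C) f g g',
    laurent f -> rational_off S g -> rational_off S g' ->
    B f (fun z => a * g z + g' z) = a^* * B f g + B f g';
  cauchy_ext : forall f f' g g', (forall z, z != 0 -> f z = f' z) ->
    (forall z, z != 0 -> S z -> \forall w \near z, g w = g' w) ->
    B f g = B f' g';
  cauchy_derive : forall f k p, laurent f -> p != 0 -> ~ S p^* ->
    is_derive p 1 (fun w => B f (fun z => (w^* - z) ^- k))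
      (B f (fun z => - k%:R * (p^* - z) ^- k.+1));
  cauchy_open : forall p, p != 0 -> ~ S p -> \forall w \near p, ~ S w
}.

Lemma laurent_rational_off S f : laurent f -> rational_off S f.
Proof.
move=> [p [N fE]]; exists p, 'X^N; split.
- by rewrite monic_neq0 ?monicXn.
- by move=> z z0 _; rewrite hornerXn expf_neq0.
- by move=> z z0 _; rewrite hornerXn fE.
Qed.

Lemma rational_offM S f g :
  rational_off S f -> rational_off S g -> rational_off S (fun z => f z * g z).
Proof.
move=> [p [q [q0 qS fE]]] [p' [q' [q'0 q'S gE]]]; exists (p * p'), (q * q'); split.
- by rewrite mulf_neq0.
- by move=> z z0 Sz; rewrite hornerM mulf_neq0 ?qS ?q'S.
- move=> z z0; rewrite !hornerM mulf_eq0 negb_or => /andP[h h'].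
  by rewrite fE// gE// mulf_div.
Qed.

Lemma rational_off_pole S (w : C) k : ~ S w -> rational_off S (fun z => (w - z) ^- k).
Proof.
move=> Sw; exists 1, ((w%:P - 'X) ^+ k); split.
- by rewrite expf_neq0// -oppr_eq0 opprB polyXsubC_eq0.
- move=> z z0 Sz; rewrite !hornerE expf_neq0// subr_eq0.
  by apply: contra_not_neq Sw => ->.
- by move=> z z0 _; rewrite !hornerE.
Qed.

Section Form.
Variables (S : set C) (B : (C -> C) -> (C -> C) -> C).
Hypothesis Bcauchy : cauchy_form S B.

Lemma near_off z (P : C -> Prop) : z != 0 ->
  (forall w, w != 0 -> P w) -> \forall w \near z, P w.
Proof.
by move=> z0 h; near=> w; apply: h; near: w; exact: near_neq0.
Unshelve. all: by end_near. Qed.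

Lemma cauchy_sesquilinear : sesquilinear_form B.
Proof.
split.
- by move=> a f f' g lf lf' lg; apply: (cauchy_linear Bcauchy) => //; exact: laurent_rational_off.
- by move=> a f f' g lf lf' lg; apply: (cauchy_antilinear Bcauchy) => //; exact: laurent_rational_off.
- move=> f f' g g' _ _ _ _ ff gg; apply: (cauchy_ext Bcauchy) => // z z0 _.
  exact: near_off.
Qed.

Lemma cauchy_scale (a : C) f g : laurent f -> rational_off S g ->
  B f (fun z => a * g z) = a^* * B f g.
Proof.
move=> lf rg; have r0 := laurent_rational_off S (laurent0 C).
have E := cauchy_antilinear Bcauchy a lf rg r0.
have B0 : B f (fun=> 0) = 0.
  have E0 := cauchy_antilinear Bcauchy (-1) lf r0 r0.
  rewrite rmorphN1 (mulN1r (B _ _)) addNr in E0; rewrite -[RHS]E0.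
  by congr B; apply/funext => z; rewrite mulr0 addr0.
rewrite B0 addr0 in E; rewrite -E; congr B.
by apply/funext => z; rewrite addr0.
Qed.

Lemma cauchy_suml K (c : 'I_K -> C) (F : 'I_K -> C -> C) g :
  (forall i, laurent (F i)) -> rational_off S g ->
  B (fun z => \sum_i c i * F i z) g = \sum_i c i * B (F i) g.
Proof.
move=> hF hg; apply: (laurent_functional_sum (F := B^~ g)) hF.
  by move=> a f f' hf hf'; exact: (cauchy_linear Bcauchy).
move=> f f' hf hf' ff'; apply: (cauchy_ext Bcauchy) => // z z0 _.
by near=> w.
Unshelve. all: by end_near. Qed.

Definition cauchy_transform f (x : C) : C := B f (fun z => (x^* - z)^-1).

Lemma near_off_conj p : p != 0 -> ~ S p^* ->
  \forall w \near p, w != 0 /\ ~ S w^*.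
Proof.
move=> p0 Sp; near=> w; split; near: w; first exact: near_neq0.
by apply: (near_conj (P := fun w => ~ S w)); apply: (cauchy_open Bcauchy) => //; rewrite conjC_eq0.
Unshelve. all: by end_near. Qed.

(** The Taylor coefficients of a Cauchy transform are pairings with powers of
    the Cauchy kernel. *)
Lemma derive1n_cauchy r f p : laurent f -> p != 0 -> ~ S p^* ->
  derive1n r (cauchy_transform f) p =
    (-1) ^+ r * r`!%:R * B f (fun z => (p^* - z) ^- r.+1).
Proof.
move=> lf; elim: r p => [|r IHr] p p0 Sp; first by rewrite mulr1 mul1r.
rewrite [LHS]/=; apply: is_derive1_val.
apply: (near_eq_is_derive (f := fun w =>
  (-1) ^+ r * r`!%:R * B f (fun z => (w^* - z) ^- r.+1))).
  near=> w; have [w0 Sw] : w != 0 /\ ~ S w^*.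
    by near: w; exact: near_off_conj.
  by rewrite IHr.
have h := is_deriveZ ((-1) ^+ r * r`!%:R) (cauchy_derive Bcauchy r.+1 lf p0 Sp).
apply: is_derive_eq h _.
rewrite cauchy_scale//; last exact: rational_off_pole.
rewrite /GRing.scale /= rmorphN rmorph_nat mulrA; congr (_ * _).
by rewrite exprS factS natrM mulN1r !mulNr mulrN -!mulrA [r.+1%:R * _]mulrC.
Unshelve. all: by end_near. Qed.

(** * The Geronimus transformation and the partial quotients *)

Variables (n : nat) (L : prepared C n) (xi : masses L).
Hypothesis SL : sigma L `&` S = set0.
Local Notation q := (@partial_quotient C n L).

(** Convertible to [geronimus2] when [B] is the pairing of a functional. *)
Definition geronimus f g : C :=
  B f (fun z => g z / leval L z) +
  \sum_(i < nzeros L) \sum_(r < mult L i)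
    (r`!%:R)^-1 * @xi i r f * (derive1n r g (zeta L i))^*.

Lemma geronimusE f g : geronimus f g = B f (fun z => g z / leval L z) +
  \sum_(i < nzeros L) \sum_(r < mult L i) @xi i r f * (taylor r g (zeta L i))^*.
Proof.
congr (_ + _); apply: eq_bigr => i _; apply: eq_bigr => r _.
by rewrite /taylor rmorphM fmorphV rmorph_nat [_^-1 * _]mulrC -mulrA [_^-1 * _]mulrC.
Qed.

Lemma leval_supp z : z != 0 -> S z -> leval L z != 0.
Proof.
move=> z0 Sz; apply/eqP => Lz; suff : (sigma L `&` S) z by rewrite SL.
by split.
Qed.

Lemma near_leval z : z != 0 -> S z -> \forall w \near z, w != 0 /\ leval L w != 0.
Proof.
move=> z0 Sz; have Lz := leval_supp z0 Sz.
have h := is_derive_continuous (laurent_is_derive (leval_laurent L) z0).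
near=> w; split; near: w; first exact: near_neq0.
exact: (@cvgr_neq0 C C C (nbhs z) _ (leval L) _ h).
Unshelve. all: by end_near. Qed.

Lemma leval_inv_rational : rational_off S (fun z => (leval L z)^-1).
Proof.
have P0 : laurent_num n (lcoef L) != 0.
  apply: contraTneq (lcoef_neq0 L) => P0; rewrite mulf_eq0 negbK; apply/orP; right.
  move: (coef_poly (2 * n).+1 (fun j => lcoef L (j%:Z - n%:Z)) 0).
  by rewrite -/(laurent_num n (lcoef L)) P0 coef0 /= sub0r => <-.
exists 'X^n, (laurent_num n (lcoef L)); split => //.
- move=> z z0 Sz; have := leval_supp z0 Sz.
  by rewrite levalE// mulf_eq0 negb_or => /andP[].
- by move=> z z0 _; rewrite levalE// invf_div hornerXn.
Qed.

Lemma zeta_off i : ~ S (zeta L i).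
Proof.
move=> Sz; suff : (sigma L `&` S) (zeta L i) by rewrite SL.
by split=> //; split; [exact: zeta_neq0|exact: leval_zeta].
Qed.

Lemma geronimus_form : sesquilinear_form geronimus.
Proof.
have rL g : laurent g -> rational_off S (fun z => g z / leval L z).
  by move=> lg; apply: rational_offM leval_inv_rational; exact: laurent_rational_off.
split.
- move=> a f f' g lf lf' lg; rewrite /geronimus (cauchy_linear Bcauchy)//; last exact: rL.
  rewrite mulrDr addrACA -[LHS]/(_ + _); congr (_ + _).
  rewrite mulr_sumr -big_split; apply: eq_bigr => i _ /=.
  rewrite mulr_sumr -big_split; apply: eq_bigr => r _ /=.
  by rewrite act_linear//; ring.
- move=> a f g g' lf lg lg'; rewrite !geronimusE mulrDr addrACA; congr (_ + _).
    rewrite -(cauchy_antilinear Bcauchy)//; [|exact: rL|exact: rL].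
    by congr B; apply/funext => z; rewrite mulrDl mulrA.
  rewrite mulr_sumr -big_split; apply: eq_bigr => i _ /=.
  rewrite mulr_sumr -big_split; apply: eq_bigr => r _ /=.
  by rewrite taylorL ?zeta_neq0// rmorphD rmorphM /=; ring.
- move=> f f' g g' lf lf' lg lg' ff gg; rewrite !geronimusE; congr (_ + _).
    apply: (cauchy_ext Bcauchy) => // z z0 _; apply: near_off => // w w0.
    by rewrite gg.
  apply: eq_bigr => i _; apply: eq_bigr => r _.
  rewrite (taylor_ext _ gg) ?zeta_neq0//; congr (_ * _).
  exact: act_ext.
Qed.

(** All jets of [L * g] at the zeros of [L] vanish, so that the masses do not
    see it. *)
Lemma geronimus_leval f g : laurent g ->
  geronimus f (fun z => leval L z * g z) = B f g.
Proof.
move=> lg; rewrite geronimusE [X in _ + X]big1 ?addr0.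
  apply: (cauchy_ext Bcauchy) => // z z0 Sz; near=> w.
  have [w0 Lw] : w != 0 /\ leval L w != 0 by near: w; exact: near_leval.
  by rewrite mulrAC mulfV ?mul1r.
move=> i _; apply: big1 => r _.
rewrite (@taylor_ext _ _ _
  (fun z => (lremove i z * g z) * (z - zeta L i) ^+ mult L i)) ?zeta_neq0//.
  rewrite taylor_mul_subrX ?zeta_neq0 1?leqNgt ?ltn_ord ?rmorph0 ?mulr0//.
  by apply: laurentM => //; exact: lremove_laurent.
by move=> z z0; rewrite (leval_lremove i)// mulrAC.
Unshelve. all: by end_near. Qed.

Definition cauchy_row f : 'rV[C]_(nmult L) :=
  jet_bar L (cauchy_transform f) - act_row xi f *m Lmatrix L.

Definition quotient_at (j : 'I_(nmult L)) : C -> C :=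
  partial_quotient (tagnat.sig1 j) (tagnat.sig2 j).

Lemma LblockE j s r :
  Lblock j s r = (taylor s (q j r) (zeta L j))^*.
Proof.
rewrite mxE taylor_partial_quotient.
have -> : (mult L j - r.+1 <= s)%N = (mult L j <= (s + r).+1)%N by lia.
case: ifP => h; last by rewrite rmorph0.
have -> : (s - (mult L j - r.+1) = (s + r).+1 - mult L j)%N.
  by have := ltn_ord r; lia.
rewrite /ell /taylor derive1n_bar ?conjC_eq0 ?zeta_neq0//; last exact: lremove_laurent.
by rewrite conjCK rmorphM fmorphV rmorph_nat mulrC.
Qed.

(** This explains the rows of the formulas.  Dividing a partial quotient by [L]
    leaves a power of [(z - zeta)^-1], whose pairing is a Taylor coefficient of
    the Cauchy transform; and the masses see only the Taylor coefficients of the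
    partial quotient at its own zero, which are the entries of [Lblock]. *)
Lemma cauchy_rowE f j : laurent f ->
  cauchy_row f ord0 j = - geronimus f (quotient_at j).
Proof.
move=> lf; rewrite /cauchy_row /quotient_at geronimusE.
have -> : act_row xi f *m Lmatrix L =
    \mxrow_(i < nzeros L) ((\row_(r < mult L i) @xi i r f) *m Lblock i).
  exact: mul_mxrow_mxdiag.
rewrite [LHS]mxE [X in X + _]mxE mxE [X in _ + X]mxE [X in _ - X = _]mxE.
move: (tagnat.sig1 j) (tagnat.sig2 j) => {j} i r.
rewrite [X in _ - X = _]mxE.
rewrite opprD; congr (_ + _).
  have z0 := zeta_neq0 i.
  rewrite derive1n_cauchy ?conjC_eq0 ?conjCK//; last exact: zeta_off.
  rewrite mulrAC mulfK; last by rewrite pnatr_eq0 -lt0n fact_gt0.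
  have -> : B f (fun z => q i r z / leval L z) =
      B f (fun z => (-1) ^+ r.+1 * (zeta L i - z) ^- r.+1).
    apply: (cauchy_ext Bcauchy) => // z z0' Sz; near=> w.
    have [w0 Lw] : w != 0 /\ leval L w != 0 by near: w; exact: near_leval.
    have E := partial_quotientE w0 (ltn_ord r).
    have q0 : q i r w != 0 by apply: contraNneq Lw => q0; rewrite E q0 mul0r.
    rewrite E invfM mulrA mulfV// mul1r -(opprB (zeta L i) w).
    by rewrite (exprNn (zeta L i - w)) invfM invr_sign.
  rewrite cauchy_scale//; last by apply: rational_off_pole; exact: zeta_off.
  by rewrite rmorphXn rmorphN1 exprS mulN1r mulNr opprK.
rewrite (bigD1 i)//= [X in _ + X]big1 ?addr0; last first.
  move=> k ki; apply: big1 => s _.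
  by rewrite taylor_partial_quotient_other// rmorph0 mulr0.
by congr (- _); apply: eq_bigr => s _; rewrite LblockE mxE.
Unshelve. all: by end_near. Qed.

End Form.
End CauchyForm.

(** * The formulas for a form with Cauchy kernels *)

Section Formulas.
Variables (C : numClosedFieldType) (S : set C) (B Bg : (C -> C) -> (C -> C) -> C).
Hypothesis Bcauchy : cauchy_form S B.
Variables (n : nat) (L : prepared C n) (xi : masses L).
Hypothesis SL : sigma L `&` S = set0.
Hypothesis BgE : forall f g, Bg f g = geronimus B xi f g.
Hypothesis Bqd : quasidefinite (gram B).
Hypothesis Bgqd : quasidefinite (gram Bg).
Variables (X : gauss_borel (gram B)) (Xg : gauss_borel (gram Bg)) (l : nat).

(** The mixed kernel is written with Cauchy transforms of [phi1], so that the
    swapped form gives the row for the other transformation. *)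
Definition remainder_row (z : C) : 'rV[C]_(nmult L) :=
  (leval L z)^* *:
    (jet_bar L (fun x => \sum_(k < l)
       (phi2 X k z)^* * (gH X k)^-1 * cauchy_transform B (phi1 X k) x)
     - act_row xi (CDkernel X l z) *m Lmatrix L)
  + map_mx Num.conj (jet L (fun x => deltaL L x z)).

(** The mixed kernel is the Cauchy transform of the kernel, and the jet of
    [deltaL] consists of values of the partial quotients. *)
Lemma remainder_rowE z j : z != 0 -> remainder_row z ord0 j =
  (quotient_at j z)^* - (leval L z)^* * Bg (CDkernel X l z) (quotient_at j).
Proof.
move=> z0; have lK := cmv_span_laurent (kernel_span X l z).
rewrite /remainder_row.
have -> : jet_bar L (fun x => \sum_(k < l)
    (phi2 X k z)^* * (gH X k)^-1 * cauchy_transform B (phi1 X k) x) =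
    jet_bar L (cauchy_transform B (CDkernel X l z)).
  apply: eq_mxrow => i; apply/rowP => r; rewrite !mxE; congr (_ / _).
  apply: derive1n_near; near=> w.
  have [w0 Sw] : w != 0 /\ ~ S w^*.
    near: w; apply: (near_off_conj Bcauchy); first by rewrite conjC_eq0 zeta_neq0.
    by rewrite conjCK; exact: zeta_off.
  rewrite /cauchy_transform (cauchy_suml Bcauchy)//.
    by move=> k; exact: phi1_laurent.
  exact: (rational_off_pole 1 Sw).
rewrite -/(cauchy_row B xi (CDkernel X l z)) [LHS]mxE [X in X + _]mxE.
rewrite (cauchy_rowE Bcauchy xi SL)// -BgE mulrN addrC; congr (_ - _).
rewrite !mxE; congr (_ ^*); rewrite -/(taylor _ _ _) taylor_deltaL//.
Unshelve. all: by end_near. Qed.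

Hypothesis n_gt0 : (1 <= n)%N.
Hypothesis l_ge : (2 * n <= l)%N.

Theorem geronimus_formulas :
  let s := (l - 2 * n)%N in
  let A := fun k => cauchy_row B xi (phi1 X k) in
  let tau k := \det (window A (k - 2 * n)) in
  let c := gH X s / (lcoef L ((-1) ^+ l * n%:Z))^* in
  tau l != 0 ->
    [/\ forall z : C, z != 0 ->
          let col := \col_i phi1 X (s + i) z in
          phi1 Xg l z = Theta (window A s) col (A l) (phi1 X l z) /\
          phi1 Xg l z =
            \det (block_mx (window A s) col (A l) (phi1 X l z)%:M) / tau l,
        gH Xg l = c * Theta (window A s) (first_col _ _) (A l) 0 /\
        gH Xg l = c * (tau l.+1 / tau l) &
        forall z : C, z != 0 ->
          (phi2 Xg l z)^* =
            - c * Theta (window A s) (first_col _ _) (remainder_row z) 0 /\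
          (phi2 Xg l z)^* =
            - c * (\det (window_last A s.+1 (remainder_row z)) / tau l)].
Proof.
move=> s A tau c tau0.
have NE := nmultE L; have lE : l = (s + nmult L)%N by rewrite NE subnK.
have Bform := cauchy_sesquilinear Bcauchy.
have Bgform : sesquilinear_form Bg.
  have -> : Bg = geronimus B xi by apply/funext => f; apply/funext => g.
  exact: (geronimus_form Bcauchy xi SL).
have BgL f g : laurent f -> laurent g -> Bg f (fun z => leval L z * g z) = B f g.
  by move=> lf lg; rewrite BgE (geronimus_leval Bcauchy xi SL).
have lead k : cmv_span (k + nmult L) (fun z => leval L z * chi k z -
    lcoef L ((-1) ^+ k * n%:Z) * chi (k + nmult L) z).
  by rewrite NE; exact: leval_chi.
have signE : lcoef L ((-1) ^+ l * n%:Z) = lcoef L ((-1) ^+ s * n%:Z).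
  by rewrite lE NE exprD mulnC exprM sqrr_sign mulr1.
have lead0 : lcoef L ((-1) ^+ s * n%:Z) != 0.
  have := lcoef_neq0 L; rewrite mulf_eq0 negb_or => /andP[].
  by rewrite -signr_odd; case: odd; rewrite ?expr1 ?mulN1r ?expr0 ?mul1r.
have q_span j : cmv_span (nmult L) (quotient_at (L := L) j).
  by rewrite [X in cmv_span X]NE; exact: partial_quotient_span.
have AE k j : A k ord0 j = - Bg (phi1 X k) (quotient_at j).
  by rewrite BgE; apply: (cauchy_rowE Bcauchy xi SL); exact: phi1_laurent.
have oddN : ~~ odd (nmult L) by rewrite NE oddM.
have N0 : (0 < nmult L)%N by rewrite NE muln_gt0.
have RE z j : z != 0 -> remainder_row z ord0 j = (quotient_at j z)^* -
    (leval L z)^* * Bg (CDkernel X (s + nmult L) z) (quotient_at j).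
  by rewrite -lE; exact: remainder_rowE.
have tauS : \det (window_last A s.+1 (A l)) = tau l.+1.
  rewrite /tau subSn//; congr (\det _); rewrite -(window_lastE A s.+1).
  by rewrite addSn -lE.
split.
- move=> z z0; have E := phi1_transformed Bform Bgform Bqd Xg BgL lead q_span AE tau0 z0.
  by rewrite -lE in E; split=> //; rewrite {1}E det_Theta.
- have E := norm_transformed Bform Bgform Bqd Xg (leval_laurent L) BgL lead lead0 q_span AE tau0 N0.
  rewrite -lE -signE in E.
  by split=> //; rewrite {1}E Theta_first_col// tauS.
- move=> z z0.
  have E := phi2_transformed Bform Bgform Bqd Bgqd Xg (leval_laurent L) BgL lead lead0 q_span AE
    RE tau0 N0 z0.
  rewrite -lE -signE in E.
  by split=> //; rewrite {1}E Theta_first_col.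
Qed.

End Formulas.

(** * Bivariate functionals *)

Section Bivariate.
Variables (C : numClosedFieldType) (u : bivariate C).

Lemma supp_supp1 x : supp u x -> supp1 u x.1 /\ x.1 != 0.
Proof.
move=> ux; have [[sub _] _ _] := supp_support u; have [x1 _] := sub _ ux.
by split=> //; split=> //; apply: subset_closure; exists x.
Qed.

Lemma supp_supp2 x : supp u x -> supp2 u x.2 /\ x.2 != 0.
Proof.
move=> ux; have [[sub _] _ _] := supp_support u; have [_ x2] := sub _ ux.
by split=> //; split=> //; apply: subset_closure; exists x.
Qed.

Lemma near_fst (x : C * C) (P : C -> Prop) :
  (\forall z \near x.1, P z) -> \forall y \near x, P y.1.
Proof. by move=> h; exact: (cvg_fst h). Qed.

Lemma near_snd (x : C * C) (P : C -> Prop) :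
  (\forall z \near x.2, P z) -> \forall y \near x, P y.2.
Proof. by move=> h; exact: (cvg_snd h). Qed.

Lemma represents_ext (F : test u) h h' :
  (forall x, supp u x -> \forall y \near x, h y = h' y) ->
  represents (supp u) F h -> represents (supp u) F h'.
Proof.
move=> hh' Fh x ux; have nF := Fh x ux; have nh := hh' x ux; near=> y.
by rewrite -(near nh y)// (near nF y).
Unshelve. all: by end_near. Qed.

Lemma representsL (a : C) (F F' : test u) h h' :
  represents (supp u) F h -> represents (supp u) F' h' ->
  represents (supp u) (a *: F + F') (fun x => a * h x + h' x).
Proof.
move=> Fh F'h' x ux; have nF := Fh x ux; have nF' := F'h' x ux; near=> y.
by rewrite (ev_linear y a F F') (near nF y)// (near nF' y).
Unshelve. all: by end_near. Qed.

Lemma pair_ext f f' g g' :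
  (forall z, z != 0 -> supp1 u z -> \forall w \near z, f w = f' w) ->
  (forall z, z != 0 -> supp2 u z -> \forall w \near z, g w = g' w) ->
  pair u f g = pair u f' g'.
Proof.
move=> ff' gg'; rewrite /pair; congr (pairing (xget _ _)).
have tE x : supp u x -> \forall y \near x, tensor f g y = tensor f' g' y.
  move=> ux; have [s1 n1] := supp_supp1 ux; have [s2 n2] := supp_supp2 ux.
  have ng := near_snd (gg' _ n2 s2); have nf := near_fst (ff' _ n1 s1).
  by near=> y; rewrite /tensor (near nf y)// (near ng y).
apply/seteqP; split=> F; apply: represents_ext => // x ux.
by have nt := tE x ux; near=> y; rewrite (near nt y).
Unshelve. all: by end_near. Qed.

Lemma pair_linear (a : C) f f' g : rational_off (supp1 u) f ->
  rational_off (supp1 u) f' -> rational_off (supp2 u) g ->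
  pair u (fun z => a * f z + f' z) g = a * pair u f g + pair u f' g.
Proof.
move=> rf rf' rg.
have [F FP] := test_tensor rf rg; have [F' F'P] := test_tensor rf' rg.
rewrite (pairE FP) (pairE F'P) -(pairing_linear a F F'); apply: pairE.
apply: represents_ext (representsL a FP F'P) => x ux.
by near=> y; rewrite /tensor mulrDl mulrA.
Unshelve. all: by end_near. Qed.

Lemma pair_antilinear (a : C) f g g' : rational_off (supp1 u) f ->
  rational_off (supp2 u) g -> rational_off (supp2 u) g' ->
  pair u f (fun z => a * g z + g' z) = a^* * pair u f g + pair u f g'.
Proof.
move=> rf rg rg'.
have [F FP] := test_tensor rf rg; have [F' F'P] := test_tensor rf rg'.
rewrite (pairE FP) (pairE F'P) -(pairing_linear a^* F F'); apply: pairE.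
apply: represents_ext (representsL a^* FP F'P) => x ux.
by near=> y; rewrite /tensor rmorphD rmorphM mulrDr mulrCA.
Unshelve. all: by end_near. Qed.

(** Differentiation under the pairing: a continuous linear functional commutes
    with the limit of difference quotients. *)
Lemma pairing_derive (kappa : C -> test u) (D : test u) (F : C -> C) p d :
  (\forall w \near p, F w = pairing (kappa w)) -> pairing D = d ->
  h^-1 *: (kappa (h + p) - kappa p) @[h --> 0^'] --> D ->
  is_derive p 1 F d.
Proof.
move=> Fk <- kD; apply: (near_eq_is_derive (f := fun w => pairing (kappa w))).
  by apply: filterS Fk => w ->.
apply/is_derive1.
have := cvg_comp _ _ kD (pairing_continuous (b := u) (x := D)).
apply: cvg_trans; apply: near_eq_cvg; apply: nearW => h /=.
have pB G G' : pairing (G - G') = pairing G - pairing G' :> C.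
  have := pairing_linear (-1) G' G; rewrite scaleN1r mulN1r [RHS]addrC => <-.
  by rewrite addrC.
have p0 : pairing (0 : test u) = 0 by rewrite -(subrr 0) pB subrr.
have := pairing_linear h^-1 (kappa (h + p) - kappa p) 0.
by rewrite addr0 p0 addr0 pB => ->.
Qed.

Lemma open_off (T : set C) p : p != 0 -> ~ (closure T `&` Cstar C) p ->
  \forall w \near p, ~ (closure T `&` Cstar C) w.
Proof.
move=> p0 Tp; have Tp' : (~` closure T) p by move=> cT; apply: Tp; split.
have := open_nbhs_nbhs (conj (closed_openC (@closed_closure _ T)) Tp').
by apply: filterS => w nT [].
Qed.

Lemma pair_cauchy_form : cauchy_form (supp2 u) (pair u).
Proof.
split.
- by move=> a f f' g lf lf' rg; apply: pair_linear => //; exact: laurent_rational_off.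
- by move=> a f g g' lf rg rg'; apply: pair_antilinear => //; exact: laurent_rational_off.
- by move=> f f' g g' ff gg; apply: pair_ext => // z z0 _; exact: near_off.
- move=> f k p lf p0 sp.
  have rf : rational_off (supp1 u) f by exact: laurent_rational_off.
  have [kappa [D [kE DE kD]]] := test_cauchy2 k rf p0 sp.
  apply: pairing_derive kD; last by rewrite (pairE DE).
  by apply: filterS kE => w wE; rewrite (pairE wE).
- by move=> p; exact: open_off.
Qed.

(** The pole enters the first slot without conjugation; the conjugation in
    [swap] restores the convention of the second slot. *)
Lemma swap_cauchy_form : cauchy_form (supp1 u) (swap (pair u)).
Proof.
split.
- move=> a f f' g lf lf' rg; rewrite /swap pair_antilinear//.
  + by rewrite rmorphD rmorphM /= conjCK.
  + exact: laurent_rational_off.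
  + exact: laurent_rational_off.
- move=> a f g g' lf rg rg'; rewrite /swap pair_linear//.
    by rewrite rmorphD rmorphM.
  exact: laurent_rational_off.
- move=> f f' g g' ff gg; congr (_ ^*); apply: pair_ext => // z z0 _.
  exact: near_off.
- move=> f k p lf p0 sp.
  have rf : rational_off (supp2 u) f by exact: laurent_rational_off.
  have cp0 : p^* != 0 by rewrite conjC_eq0.
  have [kappa [D [kE DE kD]]] := test_cauchy1 k rf cp0 sp.
  apply: (is_derive_bar (f := fun w => pair u (fun z => (w - z) ^- k) f)).
  apply: pairing_derive kD; last by rewrite (pairE DE).
  by apply: filterS kE => w wE; rewrite (pairE wE).
- by move=> p; exact: open_off.
Qed.

Lemma swap_geronimus n (L : prepared C n) (xi : masses L) f g :
  swap (geronimus1 u xi) f g = geronimus (swap (pair u)) xi f g.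
Proof.
rewrite /swap /geronimus1 /geronimus rmorphD rmorph_sum; congr (_ + _).
apply: eq_bigr => i _; rewrite rmorph_sum; apply: eq_bigr => r _.
by rewrite !rmorphM /= fmorphV rmorph_nat conjCK mulrAC.
Qed.

Lemma swap_remainder_row n (L : prepared C n) (xi : masses L)
    (X : gauss_borel (gram (pair u))) l z :
  remainder_row xi (swap_borel X) l z = Rrow1 X xi l z.
Proof.
have coefE (a b h : C) : (a^* * h^-1 * b)^* = b^* * (h^*)^-1 * a.
  by rewrite !rmorphM /= fmorphV conjCK mulrC mulrA mulrAC.
have E1 : (fun x => \sum_(k < l)
      (phi2 (swap_borel X) k z)^* * (gH (swap_borel X) k)^-1 *
      cauchy_transform (swap (pair u)) (phi1 (swap_borel X) k) x) =
    (fun x => (mixed_Cphi X l x z)^*).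
  apply/funext => x; rewrite /mixed_Cphi rmorph_sum; apply: eq_bigr => k _.
  by rewrite /= coefE.
have E2 : CDkernel (swap_borel X) l z = (fun x => (CDkernel X l x z)^*).
  apply/funext => x; rewrite /CDkernel rmorph_sum; apply: eq_bigr => k _.
  by rewrite /= coefE.
by rewrite /remainder_row E1 E2.
Qed.

End Bivariate.

(** * The theorem *)

Theorem theorem2 (R : realType) (n l : nat)
    (u : bivariate (Cplx R)) (X : gauss_borel (gram (pair u)))
    (L1 L2 : prepared (Cplx R) n) (xi1 : masses L1) (xi2 : masses L2)
    (X1 : gauss_borel (gram (geronimus1 u xi1)))
    (X2 : gauss_borel (gram (geronimus2 u xi2)))
    (hn : (1 <= n)%N) (hl : (2 * n <= l)%N)
    (hu : quasidefinite (gram (pair u)))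
    (hu1 : quasidefinite (gram (geronimus1 u xi1)))
    (hu2 : quasidefinite (gram (geronimus2 u xi2)))
    (hL1 : sigma L1 `&` supp1 u = set0)
    (hL2 : sigma L2 `&` supp2 u = set0) :
  let s := (l - 2 * n)%N in
  let A := Arow X xi2 in
  let B := Brow X xi1 in
  let tau2 k := \det (window A (k - 2 * n)) in
  let tau1 k := \det (window B (k - 2 * n)) in
  let c2 := gH X s / (lcoef L2 ((-1) ^+ l * n%:Z))^* in
  let c1 := (gH X s)^* / (lcoef L1 ((-1) ^+ l * n%:Z))^* in
  (tau2 l != 0 ->
    [/\ forall z : Cplx R, z != 0 ->
          let col := \col_i phi1 X (s + i) z in
          phi1 X2 l z = Theta (window A s) col (A l) (phi1 X l z) /\
          phi1 X2 l z =
            \det (block_mx (window A s) col (A l) (phi1 X l z)%:M) / tau2 l,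
        gH X2 l = c2 * Theta (window A s) (first_col _ _) (A l) 0 /\
        gH X2 l = c2 * (tau2 l.+1 / tau2 l) &
        forall z : Cplx R, z != 0 ->
          (phi2 X2 l z)^* =
            - c2 * Theta (window A s) (first_col _ _) (Rrow2 X xi2 l z) 0 /\
          (phi2 X2 l z)^* =
            - c2 * (\det (window_last A s.+1 (Rrow2 X xi2 l z)) / tau2 l)])
  /\
  (tau1 l != 0 ->
    [/\ forall z : Cplx R, z != 0 ->
          let col := \col_i phi2 X (s + i) z in
          phi2 X1 l z = Theta (window B s) col (B l) (phi2 X l z) /\
          phi2 X1 l z =
            \det (block_mx (window B s) col (B l) (phi2 X l z)%:M) / tau1 l,
        (gH X1 l)^* = c1 * Theta (window B s) (first_col _ _) (B l) 0 /\
        (gH X1 l)^* = c1 * (tau1 l.+1 / tau1 l) &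
        forall z : Cplx R, z != 0 ->
          (phi1 X1 l z)^* =
            - c1 * Theta (window B s) (first_col _ _) (Rrow1 X xi1 l z) 0 /\
          (phi1 X1 l z)^* =
            - c1 * (\det (window_last B s.+1 (Rrow1 X xi1 l z)) / tau1 l)]).
Proof.
move=> s A B tau2 tau1 c2 c1; split.
  have E f g : geronimus2 u xi2 f g = geronimus (pair u) xi2 f g by [].
  exact: (geronimus_formulas (pair_cauchy_form u) hL2 E hu hu2 X2 hn hl (X := X)).
move=> h1.
have [F1 F2 F3] := geronimus_formulas (swap_cauchy_form u) hL1
  (swap_geronimus u xi1)
  (swap_quasidefinite hu) (swap_quasidefinite hu1) (swap_borel X1)
  hn hl (X := swap_borel X) h1.
split; [exact: F1|exact: F2|move=> z z0].
have := F3 z z0; rewrite swap_remainder_row; exact.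
Qed.
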